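(* Let $k/\mathbf{Q}$ be a finite field extension, and let $n\ge 2$ and $j\ge 1$ be integers. Let \[T(C_n^j;x,y)=x^{n-1}+\big(y+x+x^2+\cdots+x^{n-2}\big)\big(1+y+\cdots+y^{j-1}\big),\] the Tutte polynomial of the multigraph $C_n^j$ obtained from a path of length $n-1$ with endpoints $u,v$ by adding $j$ parallel edges joining $u$ and $v$. Suppose that (1) $n-1\in\{p,p^2\}$ for some prime number $p\geq 5$; (2) $-j$ is a nonsquare modulo $p$; and (3) $\gcd(n,j-1)=1$. Then $G_{k,y}(T(C_n^j;x,y))\simeq\mathfrak S_{n-1}$.
   Context: For a field $k$ and a polynomial $T(x,y)$ over $k$, $G_{k,y}(T)$ denotes the Galois group of the splitting field of $T$, seen as a polynomial in $x$ over $k(y)$, inside a fixed separable closure of $k(y)$. *)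

(* Defs.v *)
From Stdlib Require Classical_Prop.
From HB Require Import structures.
From mathcomp Require Import all_boot all_order all_algebra.
From mathcomp Require Import all_fingroup all_field.

Set Implicit Arguments.
Unset Strict Implicit.
Unset Printing Implicit Defensive.

Import GRing.Theory.
Local Open Scope ring_scope.

(* Finite multigraphs: [ends e] lists the two endpoints of the undirected edge
   [e]; loops and parallel edges are allowed. *)
Record multigraph := Multigraph {
  vertex : finType;
  edge : finType;
  ends : edge -> vertex * vertex }.

Section Tutte.
Variable G : multigraph.

Definition joined (A : {set edge G}) : rel (vertex G) :=
  fun u v => [exists e in A, (ends e == (u, v)) || (ends e == (v, u))].

Definition graph_rank (A : {set edge G}) : nat :=
  (#|vertex G| - n_comp (joined A) [pred _ : vertex G | true])%N.

(* Bivariate polynomials are elements of {poly {poly R}}: the outer variable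
   'X is x, and the inner one, 'Y = ('X)%:P, is y. *)
Definition tutte (R : nzRingType) : {poly {poly R}} :=
  \sum_(A : {set edge G})
     ('X - 1) ^+ (graph_rank [set: edge G] - graph_rank A)
     * ('Y - 1) ^+ (#|A| - graph_rank A).

End Tutte.

(* The path of length n - 1, whose i-th edge joins i and i + 1, together with j
   edges joining its endpoints. *)
Definition C_graph (n j : nat) : multigraph :=
  @Multigraph 'I_(n - 1).+1 ('I_(n - 1) + 'I_j)%type
    (fun e => match e with
              | inl i => (widen_ord (leqnSn _) i, lift ord0 i)
              | inr _ => (ord0, ord_max)
              end).

Definition tutte_C (R : nzRingType) (n j : nat) : {poly {poly R}} :=
  'X^(n - 1) + ('Y + \sum_(1 <= i < n - 1) 'X^i)
               * \sum_(0 <= i < j) 'Y ^+ i.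

Lemma joined_sym (G : multigraph) (A : {set edge G}) : symmetric (joined A).
Proof. by move=> u v; apply: eq_existsb => e; rewrite orbC. Qed.

Lemma joined_connect_sym (G : multigraph) (A : {set edge G}) :
  connect_sym (joined A).
Proof. exact/sym_connect_sym/joined_sym. Qed.

Lemma joinedU1 (G : multigraph) (A : {set edge G}) (e : edge G) u v :
  joined (e |: A) u v =
  [|| ends e == (u, v), ends e == (v, u) | joined A u v].
Proof.
apply/existsP/idP => [[f]|].
  rewrite in_setU1 => /andP[/orP[/eqP->|fA] h]; first by rewrite orbA h.
  by apply/orP; right; apply/orP; right; apply/existsP; exists f; rewrite fA.
rewrite orbA => /orP[h|/existsP[f /andP[fA h]]].
  by exists e; rewrite setU11.
by exists f; rewrite setU1r.
Qed.

Local Notation ncomp A := (n_comp (joined A) [pred _ | true]).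

Lemma ncompU1 (G : multigraph) (A : {set edge G}) (e : edge G) :
  ncomp A = (ncomp (e |: A)
             + ~~ connect (joined A) (ends e).1 (ends e).2)%N.
Proof.
set u := (ends e).1; set v := (ends e).2.
have euv : ends e = (u, v) by rewrite /u /v; case: (ends e).
have cs := @joined_connect_sym G.
pose a := closure (joined A) (pred2 u v).
have ua : u \in a by apply: (mem_closure (joined A)); rewrite !inE eqxx.
have va : v \in a by apply: (mem_closure (joined A)); rewrite !inE eqxx orbT.
have clA : closed (joined A) a := closure_closed (cs A) _.
have clB : closed (joined (e |: A)) a.
  move=> x y; rewrite joinedU1 euv !xpair_eqE => /or3P[|| /clA //].
    by case/andP=> /eqP<- /eqP<-; rewrite ua va.
  by case/andP=> /eqP<- /eqP<-; rewrite ua va.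
have sub : subrel (joined A) (joined (e |: A)).
  by move=> x y h; rewrite joinedU1 h !orbT.
have sub' x y : connect (joined A) x y -> connect (joined (e |: A)) x y.
  by apply: connect_sub => {x y} x y /sub/connect1.
have uvB : connect (joined (e |: A)) u v.
  by apply: connect1; rewrite joinedU1 euv eqxx.
have aB : a =i closure (joined (e |: A)) (pred2 u v).
  move=> x; apply/idP/idP => [/pred0Pn[z /andP[xz zuv]]|].
    by apply/pred0Pn; exists z; apply/andP; split; first exact: sub'.
  case/pred0Pn=> z /andP[/= xz zuv].
  by rewrite (closed_connect clB xz); case/pred2P: zuv => ->.
have nA : n_comp (joined A) a = (~~ connect (joined A) u v).+1.
  exact: n_comp_closure2.
have nB : n_comp (joined (e |: A)) a = 1%N.
  by rewrite (eq_n_comp_r aB) n_comp_closure2 // uvB.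
rewrite !(n_compC a) nA nB.
suff -> : n_comp (joined A) [predC a] = n_comp (joined (e |: A)) [predC a].
  by rewrite [RHS]addnAC add1n.
have clAc := predC_closed clA; have clBc := predC_closed clB.
apply: (adjunction_n_comp id); rewrite //.
split=> [y ya|x y xa]; first by exists y; apply: connect0.
apply/idP/idP; last exact: sub'.
case/connectP=> p; elim: p x xa => [|z p IHp] x xa /= => [_ ->|].
  exact: connect0.
case/andP=> xz pz ly; have za : z \in [predC a] by rewrite -(clBc _ _ xz).
apply: connect_trans (IHp z za pz ly); apply: connect1.
move: xz; rewrite joinedU1 euv !xpair_eqE => /or3P[|| //].
  by case/andP=> /eqP ux _; rewrite inE -ux ua in xa.
by case/andP=> _ /eqP vx; rewrite inE -vx va in xa.
Qed.

Section CGraph.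
Variables n j : nat.
Local Notation m := (n - 1)%N.
Local Notation G := (C_graph n j).

Definition Cedges (A : {set 'I_m}) (B : {set 'I_j}) : {set edge G} :=
  [set e : edge G | match e with inl i => i \in A | inr i => i \in B end].

Lemma CedgesUl i A B : Cedges (i |: A) B = (inl i : edge G) |: Cedges A B.
Proof. by apply/setP=> -[a|b]; rewrite !inE. Qed.

Lemma CedgesUr i A B : Cedges A (i |: B) = (inr i : edge G) |: Cedges A B.
Proof. by apply/setP=> -[a|b]; rewrite !inE. Qed.

Lemma C_ncomp0 : ncomp (Cedges set0 set0) = m.+1.
Proof.
rewrite -[RHS]card_ord; apply: eq_card => x; rewrite !inE andbT /=.
have E : connect (joined (Cedges set0 set0)) x =1 pred1 x.
  move=> y; rewrite /= eq_sym.
  apply/connectP/eqP => [[[|z p] //= /andP[+ _]]|->].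
    by case/existsP=> -[e|e]; rewrite !inE.
  by exists [::].
have := connect_root (joined (Cedges set0 set0)) x.
by rewrite -[connect _ _ _]/(connect (joined (Cedges set0 set0)) x _) E.
Qed.

Lemma C_cut (i : 'I_m) (A : {set 'I_m}) :
  i \notin A -> closed (joined (Cedges A set0)) [pred v : 'I_m.+1 | v <= i]%N.
Proof.
move=> iA; apply: intro_closed => [|u v]; first exact: joined_connect_sym.
case/existsP=> -[a|b]; rewrite !inE // => /andP[aA].
have nai : (a : nat) != i by apply: contraNneq iA => /val_inj<-.
rewrite /= !xpair_eqE => /orP[] /andP[/eqP<- /eqP<-] /=; rewrite /bump /= => h.
  by rewrite ltn_neqAle nai.
exact: ltnW.
Qed.

Lemma ncomp_path (A : {set 'I_m}) : (ncomp (Cedges A set0) + #|A|)%N = m.+1.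
Proof.
move: {2}#|A| (erefl #|A|) => c; elim: c A => [|c IHc] A hA.
  by move/eqP: hA; rewrite cards_eq0 => /eqP->; rewrite C_ncomp0 cards0 addn0.
have /card_gt0P[i iA] : (0 < #|A|)%N by rewrite hA.
have hA' : #|A :\ i| = c by move: hA; rewrite (cardsD1 i) iA => -[].
rewrite -(IHc _ hA') (ncompU1 (Cedges (A :\ i) set0) (inl i : edge G)).
rewrite -CedgesUl setD1K // hA hA'.
suff -> : ~~ connect (joined (Cedges (A :\ i) set0))
   (ends (inl i : edge G)).1 (ends (inl i : edge G)).2 by rewrite addn1 addSnnS.
apply/negP; have := @C_cut i (A :\ i); rewrite !inE eqxx => /(_ isT) cl.
by move/(closed_connect cl); rewrite !inE /= leqnn /bump /= ltnn.
Qed.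

Lemma ncomp_C (A : {set 'I_m}) (B : {set 'I_j}) :
  (ncomp (Cedges A B) + #|A| + ((A != setT) && (B != set0)))%N = m.+1.
Proof.
move: {2}#|B| (erefl #|B|) => c; elim: c B => [|c IHc] B hB.
  move/eqP: hB; rewrite cards_eq0 => /eqP->.
  by rewrite eqxx andbF addn0 ncomp_path.
have /card_gt0P[i iB] : (0 < #|B|)%N by rewrite hB.
have hB' : #|B :\ i| = c by move: hB; rewrite (cardsD1 i) iB => -[].
have B0 : B != set0 by rewrite -cards_eq0 hB.
rewrite -(IHc _ hB') (ncompU1 (Cedges A (B :\ i)) (inr i : edge G)).
rewrite -CedgesUr setD1K //.
rewrite B0 andbT -!addnA; congr (_ + _)%N; rewrite [RHS]addnCA; congr (_ + _)%N.
have [->|/set0Pn[b bB]] /= := eqVneq (B :\ i) set0; last first.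
  suff -> : connect (joined (Cedges A (B :\ i))) ord0 ord_max by rewrite andbT.
  apply: connect1; apply/existsP; exists (inr b : edge G).
  by rewrite inE bB /= eqxx.
rewrite andbF addn0; congr nat_of_bool.
have [->|] /= := eqVneq A setT; last first.
  move=> AT; apply/esym/negP; have [a aA] : exists a, a \notin A.
    by apply/existsP; apply: contraR AT; rewrite negb_exists => /forallP h;
      apply/eqP/setP=> a; rewrite inE; move: (h a); rewrite negbK.
  by move/(closed_connect (C_cut aA)); rewrite !inE /= leq0n leqNgt ltn_ord.
apply/esym/negPn; suff H v (hv : (v < m.+1)%N) :
  connect (joined (Cedges setT set0)) ord0 (Ordinal hv : 'I_m.+1) by exact: H.
elim: v hv => [|v IHv] hv.
  by rewrite (_ : Ordinal hv = ord0) ?connect0 //; apply: val_inj.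
apply: connect_trans (IHv (ltnW hv)) _; apply: connect1; apply/existsP.
exists (inl (Ordinal (hv : v < m)%N) : edge G); rewrite !inE /= xpair_eqE.
by apply/orP; left; apply/andP; split; apply/eqP/val_inj.
Qed.

Lemma graph_rank_C (A : {set 'I_m}) (B : {set 'I_j}) :
  graph_rank (Cedges A B) = (#|A| + ((A != setT) && (B != set0)))%N.
Proof. by rewrite /graph_rank card_ord -(ncomp_C A B) -addnA addKn. Qed.

Lemma card_Cedges A B : #|Cedges A B| = (#|A| + #|B|)%N.
Proof.
by rewrite -sum1_card big_sumType /= -!sum1_card; congr (_ + _)%N;
  apply: eq_bigl => a; rewrite inE.
Qed.

End CGraph.

Lemma sum_set_expr (R : comNzRingType) (T : finType) (z : R) :
  \sum_(A : {set T}) z ^+ #|A| = (z + 1) ^+ #|T|.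
Proof.
transitivity (\prod_(i : T) (z + 1)); last by rewrite prodr_const.
rewrite bigA_distr; apply: eq_bigr => A _.
by rewrite -big_mkcond /= prodr_const.
Qed.

Lemma rank_sum (R : idomainType) (m j : nat) (x y : R) :
  (0 < m)%N -> x - 1 != 0 -> y - 1 != 0 ->
  \sum_(A : {set 'I_m}) \sum_(B : {set 'I_j})
     (x - 1) ^+ (m - (#|A| + ((A != setT) && (B != set0))))
     * (y - 1) ^+ (#|A| + #|B| - (#|A| + ((A != setT) && (B != set0))))
  = x ^+ m + (y + \sum_(1 <= i < m) x ^+ i) * \sum_(0 <= i < j) y ^+ i.
Proof.
move=> m1 nzX nzY.
pose P := \sum_(A : {set 'I_m} | A != setT) (x - 1) ^+ (m - #|A| - 1).
pose Q := \sum_(B : {set 'I_j} | B != set0) (y - 1) ^+ (#|B| - 1).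
have sumA : \sum_(A : {set 'I_m}) (x - 1) ^+ (m - #|A|) = x ^+ m.
  rewrite (reindex_inj (@setC_inj _)) /=.
  rewrite -[in RHS](subrK 1 x) -[in RHS](card_ord m) -sum_set_expr.
  have mE (A : {set 'I_m}) : m = (#|A| + #|~: A|)%N by rewrite cardsC card_ord.
  by apply: eq_bigr => A _; rewrite {1}(mE A) addnK.
have PE : P = \sum_(i < m) x ^+ i.
  apply: (mulfI nzX); rewrite -subrX1 -sumA (bigD1 setT) //= cardsT card_ord.
  rewrite subnn expr0 [RHS]addrC addKr big_distrr /=; apply: eq_bigr => A AT.
  rewrite -exprS subn1 prednK // subn_gt0 -[m in X in (_ < X)%N]card_ord.
  by rewrite -cardsT proper_card // properE subsetT subTset.
have QE : Q = \sum_(i < j) y ^+ i.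
  apply: (mulfI nzY); rewrite -subrX1 -[in RHS](subrK 1 y).
  rewrite -[in RHS](card_ord j) -sum_set_expr (bigD1 set0) //= cards0 expr0.
  rewrite [RHS]addrC addKr big_distrr /=; apply: eq_bigr => B B0.
  by rewrite -exprS subn1 prednK // card_gt0.
pose F (A : {set 'I_m}) (B : {set 'I_j}) : R :=
  (x - 1) ^+ (m - (#|A| + ((A != setT) && (B != set0))))
  * (y - 1) ^+ (#|A| + #|B| - (#|A| + ((A != setT) && (B != set0)))).
have F0 A : F A set0 = (x - 1) ^+ (m - #|A|).
  rewrite /F eqxx andbF cards0.
  by rewrite (subnn (#|A| + 0)) mulr1 addn0.
have FT B : B != set0 -> F setT B = (y - 1) * (y - 1) ^+ (#|B| - 1).
  move=> B0; rewrite /F eqxx addn0 cardsT card_ord.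
  rewrite (subnn m) mul1r (addKn m) -exprS subn1 prednK //.
  by rewrite card_gt0.
have FP A B : A != setT -> B != set0 ->
    F A B = (x - 1) ^+ (m - #|A| - 1) * (y - 1) ^+ (#|B| - 1).
  by move=> AT B0; rewrite /F AT B0 (subnDA #|A| m) (subnDl #|A|).
transitivity (\sum_A \sum_B F A B) => //.
rewrite exchange_big (bigD1 set0) //=.
have -> : \sum_A F A set0 = x ^+ m.
  by rewrite -sumA; apply: eq_bigr => A _; apply: F0.
have -> : \sum_(B : {set 'I_j} | B != set0) \sum_A F A B = (y - 1 + P) * Q.
  rewrite big_distrr; apply: eq_bigr => B B0.
  rewrite (bigD1 setT) //= FT // [RHS]mulrDl /P big_distrl; congr (_ + _).
  by apply: eq_bigr => A AT; rewrite FP.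
rewrite PE QE big_mkord; congr (_ + _ * _).
by rewrite -(big_mkord xpredT (fun i => x ^+ i)) big_ltn // expr0 addrA subrK.
Qed.

Lemma tutte_C_graph (k : idomainType) (n j : nat) :
  (2 <= n)%N -> (1 <= j)%N -> tutte (C_graph n j) k = tutte_C k n j.
Proof.
move=> n2 j1; have m1 : (0 < n - 1)%N by rewrite subn_gt0.
have nzX : 'X - 1 != 0 :> {poly {poly k}} by rewrite polyXsubC_eq0.
have nzY : 'Y - 1 != 0 :> {poly {poly k}}.
  by rewrite -polyC1 -polyCB polyC_eq0 -polyC1 polyXsubC_eq0.
apply: etrans (rank_sum j m1 nzX nzY).
have rkT : graph_rank [set: edge (C_graph n j)] = (n - 1)%N.
  have -> : [set: edge (C_graph n j)] = Cedges setT setT.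
    by apply/setP=> -[a|b]; rewrite !inE.
  by rewrite graph_rank_C eqxx addn0 cardsT card_ord.
rewrite /tutte rkT.
rewrite (reindex (fun p : {set 'I_(n - 1)} * {set 'I_j} => Cedges p.1 p.2)) /=;
  last first.
  exists (fun S : {set edge (C_graph n j)} =>
     ([set a | (inl a : edge (C_graph n j)) \in S],
      [set b | (inr b : edge (C_graph n j)) \in S])) => [[A B] _|S _] /=.
    by congr (_, _); apply/setP=> a; rewrite !inE.
  by apply/setP=> -[a|b]; rewrite !inE.
rewrite pair_bigA; apply: eq_bigr => -[A B] _ /=.
by rewrite graph_rank_C card_Cedges.
Qed.

(* T as a polynomial in x over the field k(y). *)
Definition over_ratfun (k : fieldType) (T : {poly {poly k}}) :
  {poly {fraction {poly k}}} := map_poly (@tofrac {poly k}) T.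

Local Notation "p ^%:A" := (map_poly (in_alg _) p)
  (at level 2, format "p ^%:A") : ring_scope.

Lemma irreducible_dvdp (F : fieldType) (p : {poly F}) :
  (1 < size p)%N -> exists2 r : {poly F}, r %| p & irreducible_poly r.
Proof.
elim: {p}(size p) {-2}p (leqnn (size p)) => [|s IHs] p ps p1.
  by rewrite ltnNge (leq_trans ps) in p1.
have [irr|red] := Classical_Prop.classic (irreducible_poly p).
  by exists p.
have [q [q1 qp nqp]] :
    exists q : {poly F}, [/\ size q != 1%N, q %| p & ~~ (q %= p)].
  apply: Classical_Prop.NNPP => h; apply: red; split=> // q q1 qp.
  by apply: contraT => nqp; case: h; exists q.
have nz_p : p != 0 by rewrite -size_poly_gt0 ltnW.
have lt_q : (size q < size p)%N.
  by rewrite ltn_neqAle dvdp_size_eqp // nqp dvdp_leq.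
have [||r rq irr] := IHs q; first by rewrite -ltnS (leq_trans lt_q).
  by rewrite ltn_neqAle eq_sym q1 size_poly_gt0 (dvdpN0 qp).
by exists r => //; apply: dvdp_trans rq qp.
Qed.

Lemma exists_splits (F : fieldType) (p : {poly F}) : p != 0 ->
  exists (L : fieldExtType F) (zs : seq L),
    p^%:A %= \prod_(z <- zs) ('X - z%:P).
Proof.
move: {2}_.+1 (ltnSn (size p)) => n; elim: n => // n IHn in F p * => lbn nz_p.
have [Cp|C'p] := leqP (size p) 1.
  exists F^o, [::].
  by rewrite big_nil -size_poly_eq1 size_map_poly eqn_leq Cp size_poly_gt0.
have [r r_dv_p irr_r] := irreducible_dvdp C'p.
have{irr_r} [K _ [x rx0 defK]] := irredp_FAdjoin irr_r.
have{r rx0 r_dv_p} /factor_theorem[q Dp] : root (p^%:A : {poly K}) x.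
  by rewrite -(divpK r_dv_p) rmorphM rootM rx0 orbT.
have Dszp: size p = size (q * ('X - x%:P)) by rewrite -Dp size_map_poly.
have nz_q: q != 0.
  by move: nz_p; rewrite -size_poly_eq0 Dszp size_poly_eq0 mulf_eq0 => /norP[].
have [L [zs Dq]] : exists (L : fieldExtType K) (zs : seq L),
    q^%:A %= \prod_(z <- zs) ('X - z%:P).
  apply: (IHn K q _ nz_q).
  by rewrite ltnS Dszp size_mul ?polyXsubC_eq0 ?size_XsubC ?addn2 in lbn.
suffices: exists zs : seq L,
    ((p^%:A : {poly K})^%:A : {poly L}) %= \prod_(z <- zs) ('X - z%:P).
  rewrite -[_^%:A]map_poly_comp.
  rewrite -(eq_map_poly (fun a : F => baseField_scaleE a 1)).
  by exists (baseFieldType L).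
exists (x%:A :: zs); rewrite big_cons; set rhs := _ * _.
by rewrite Dp mulrC rmorphM /= rmorphB /= map_polyX map_polyC /= eqp_mull.
Qed.

(* The splitting fields over which the Galois groups are taken do exist. *)
Lemma exists_splittingField (F : fieldType) (p : {poly F}) : p != 0 ->
  exists L : splittingFieldType F, splittingFieldFor 1 p^%:A {:L}.
Proof.
have mapXsubC (U V : fieldType) (f : {rmorphism U -> V}) x:
    map_poly f ('X - x%:P) = 'X - (f x)%:P.
  by rewrite rmorphB /= map_polyX map_polyC.
move=> nz_p; suffices [L splitLp] :
    exists L : fieldExtType F, splittingFieldFor 1 (p^%:A : {poly L}) {:L}.
  have ax : SplittingField.axiom L.
    by exists p^%:A => //; apply/polyOver1P; exists p.
  pose M := FieldExt_isSplittingField.Build F L ax.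
  pose S : splittingFieldType F := HB.pack L M.
  by exists S.
have [L [ys Dp]] := exists_splits nz_p.
pose Lp := subvs_of <<1 & ys>>; pose toL := linfun (vsval : Lp -> L).
have [zs Dys]: exists zs, map toL zs = ys.
  exists (map (vsproj _) ys); rewrite -map_comp map_id_in // => y ys_y.
  by rewrite /= lfunE /= vsprojK ?seqv_sub_adjoin.
exists Lp; exists zs.
  set lhs := (lhs in lhs %= _); set rhs := (rhs in _ %= rhs).
  suffices: map_poly toL lhs %= map_poly toL rhs by rewrite eqp_map.
  rewrite -Dys big_map in Dp; apply: etrans Dp; apply: congr2.
    by rewrite -map_poly_comp; apply/eq_map_poly=> x; apply: rmorph_alg.
  by rewrite rmorph_prod; apply/eq_bigr=> z _; apply: mapXsubC.
set Lzs := LHS; pose Lys := (toL @: Lzs)%VS; apply/vspaceP=> u.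
have: val u \in Lys by rewrite /Lys aimg_adjoin_seq aimg1 Dys (valP u).
by case/memv_imgP=> v Lzs_v; rewrite memvf lfunE => /val_inj->.
Qed.

(* Main.v *)
(* Write [m = n - 1], [J = 1 + y + ... + y^(j-1)] and let [H], a subgroup of
   ['S_m], be the image of the Galois group acting on the roots of
   [T = x^m + J (y + x + ... + x^(m-1))].  The only tool linking [H] to the
   various specializations of [y] is the following: if a polynomial [P] in the
   roots of [T] takes a value [a] in [k[y]], then under any specialization the
   image of [a] is [P] evaluated at the roots of the specialized polynomial,
   taken in some order.

   - [H] is transitive: at a root of [J] all roots of [T] vanish, whereas their
     product [+- y J] vanishes there only simply (Eisenstein).
   - [H] contains a transposition, by inertia, as soon as the discriminant [D]
     of [T] in [x] has a simple zero.  One has [y D = +- J^(m-1) Q] for some [Q]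
     in [Z[y]], which is congruent to [J y^(j(m-2)+1)] modulo [p] because
     [1 + x + ... + x^(m-1) = (x-1)^(m-1)] there.  As [p] does not divide [j],
     [J] is separable modulo [p], so [Q] has a simple nonzero root.
   - The relation "equal or exchanged by a transposition of [H]" cuts the roots
     into blocks of a common size [d > 1].  At [y = infinity] one root has
     valuation [1 - j] and the other ones [- 1 / (m-1)], which forces [m - 1]
     to divide [d - 1].  Hence [d = m] and [H] contains all transpositions. *)
Require Import Defs.
From HB Require Import structures.
From mathcomp Require Import all_boot all_order all_algebra all_fingroup all_field.
From mathcomp Require Import ring zify.
From mathcomp.multinomials Require Import mpoly.
Import GRing.Theory.
Local Open Scope ring_scope.

Set Implicit Arguments.
Unset Strict Implicit.
Unset Printing Implicit Defensive.

(** * Evaluation of symmetric polynomials at the roots of a polynomial *)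

Section SymmetricEvaluation.
Variable m : nat.

Lemma mmapXU (A : comNzRingType) (R : comNzRingType) (f : {rmorphism A -> R})
  (v : 'I_m -> R) i : mmap f v 'X_i = v i.
Proof. by rewrite mmapX mmap1U. Qed.

Lemma mmap_morph (A B R : comNzRingType) (g : {rmorphism A -> B})
  (f : {rmorphism B -> R}) (v : 'I_m -> B) (P : {mpoly A[m]}) :
  f (mmap g v P) = mmap (f \o g) (f \o v) P.
Proof.
rewrite /mmap raddf_sum; apply: eq_bigr => u _.
rewrite /= rmorphM; congr (_ * _); rewrite /mmap1 rmorph_prod.
by apply: eq_bigr => i _; rewrite rmorphXn.
Qed.

Lemma eq_mmap (A R : comNzRingType) (f g : A -> R) (v w : 'I_m -> R) P :
  f =1 g -> v =1 w -> mmap f v P = mmap g w P.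
Proof. by move=> fg vw; apply: eq_bigr => u _; rewrite fg (mmap1_eq _ vw). Qed.

Lemma mmap_msym (A R : comNzRingType) (f : {rmorphism A -> R}) (v : 'I_m -> R)
  (s : 'S_m) (P : {mpoly A[m]}) :
  mmap f v (msym s P) = mmap f (fun i => v (s i)) P.
Proof.
rewrite /msym (mmap_morph (@mpolyC m A) (mmap f v)).
by apply: eq_mmap => x; rewrite /= ?mmapC ?mmapXU.
Qed.

Lemma mmap_comp_mesym (A R : comNzRingType) (f : {rmorphism A -> R})
  (v : 'I_m -> R) (t : {mpoly A[m]}) :
  mmap f v (t \mPo [tuple mesym m A i.+1 | i < m])
  = mmap f (fun i : 'I_m => (mesym m R i.+1).@[v]) t.
Proof.
rewrite /comp_mpoly (mmap_morph (@mpolyC m A) (mmap f v)).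
apply: eq_mmap => x; rewrite /= ?mmapC // tnth_mktuple.
rewrite /mesym !raddf_sum; apply: eq_bigr => h _.
rewrite /= !rmorph_prod; apply: eq_bigr => j _ /=.
by rewrite mmapXU mevalXU.
Qed.

Lemma mesym_roots (A : comNzRingType) (R : idomainType) (f : {rmorphism A -> R})
  (T : {poly A}) (v : 'I_m -> R) (i : 'I_m) :
  map_poly f T = \prod_(i < m) ('X - (v i)%:P) ->
  (mesym m R i.+1).@[v] = f ((-1) ^+ i.+1 * T`_(m - i.+1)).
Proof.
move=> fT; pose k := Ordinal (ltn_ord i : (i.+1 < m.+1)%N).
have := mroots_coeff (mktuple v) k; rewrite big_tuple.
under eq_bigr do rewrite tnth_mktuple.
rewrite -fT coef_map /= rmorphM rmorphXn rmorphN1 => ->.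
rewrite mulrA -exprMn mulrNN mulr1 expr1n mul1r.
by apply: meval_eq => l; rewrite tnth_mktuple.
Qed.

(** Up to sign the elementary symmetric functions of the roots are coefficients of [T], so one [q]
    serves every domain over which [T] splits. The sigma type lets later definitions project [q]
    out. *)
Lemma symmetric_eval (A : comNzRingType) (T : {poly A}) (S : {mpoly A[m]}) :
  S \is symmetric ->
  {q : A | forall (R : idomainType) (f : {rmorphism A -> R}) (v : 'I_m -> R),
     map_poly f T = \prod_(i < m) ('X - (v i)%:P) -> f q = mmap f v S}.
Proof.
case/sym_fundamental=> t [<- _].
exists (t.@[fun i : 'I_m => (-1) ^+ i.+1 * T`_(m - i.+1)]) => R f v fT.
rewrite mmap_comp_mesym [X in f X]/meval (mmap_morph idfun f).
by apply: eq_mmap => i //=; rewrite (mesym_roots _ fT).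
Qed.

(* The resolvent [\prod_s (a - P(X_(s i)))] vanishes at one system of roots,
   hence, being symmetric, at any other one. *)
Lemma mpoly_specialize (A : comNzRingType) (T : {poly A}) (R S : idomainType)
  (f : {rmorphism A -> R}) (g : {rmorphism A -> S})
  (v : 'I_m -> R) (w : 'I_m -> S) (P : {mpoly A[m]}) (a : A) :
  injective f ->
  map_poly f T = \prod_(i < m) ('X - (v i)%:P) ->
  map_poly g T = \prod_(i < m) ('X - (w i)%:P) ->
  mmap f v P = f a ->
  exists s : 'S_m, g a = mmap g (fun i => w (s i)) P.
Proof.
move=> f_inj fT gT Pa; pose Q := \prod_(s : 'S_m) (a%:MP - msym s P).
have symQ : Q \is symmetric.
  apply/issymP => s; rewrite rmorph_prod /= [RHS](reindex_inj (mulIg s)) /=.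
  apply: eq_bigr => r _; rewrite rmorphB /=; congr (_ - _).
    by rewrite /msym mmapC.
  apply/mpolyP => u; rewrite !mcoeff_sym; congr (_@_ _).
  by apply/mnmP => i; rewrite !mnmE permM.
have [q qE] := symmetric_eval T symQ.
have q0 : q = 0.
  apply: f_inj; rewrite (qE _ _ _ fT) rmorph0 rmorph_prod (bigD1 1%g) //=.
  rewrite rmorphB /= mmapC mmap_msym (eq_mmap _ (g := f) (w := v)) ?Pa ?subrr ?mul0r //.
  by move=> i; rewrite perm1.
have /esym/eqP := qE _ _ _ gT; rewrite q0 rmorph0 rmorph_prod prodf_seq_eq0.
case/hasP=> s _ /andP[_]; rewrite rmorphB /= mmapC mmap_msym subr_eq0.
by move/eqP => E; exists s.
Qed.

Lemma integral_mmap (A : comNzRingType) (R : comNzRingType)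
  (f : {rmorphism A -> R}) (v : 'I_m -> R) (P : {mpoly A[m]}) :
  (forall i, integralOver f (v i)) -> integralOver f (mmap f v P).
Proof.
move=> int_v; have intX i e : integralOver f (v i ^+ e).
  elim: e => [|e IHe]; first by rewrite expr0; apply: integral1.
  by rewrite exprS; apply: integral_mul.
rewrite /mmap; elim/big_ind: _ => [||u _]; first exact: integral0.
  by move=> x y; apply: integral_add.
apply: integral_mul; first exact: integral_id.
rewrite /mmap1; elim/big_ind: _ => [||i _] //; first exact: integral1.
by move=> x y; apply: integral_mul.
Qed.

End SymmetricEvaluation.

(** * Integral closedness of k[y], root extensions, multiple zeros of determinants *)

Lemma fraction_quotient (R : idomainType) (c : {fraction R}) :
  exists n d : R, d != 0 /\ c * @FracField.tofrac R d = @FracField.tofrac R n.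
Proof.
elim/quotW: c => x; have dx := denom_ratioP x.
exists (frac x).1, (frac x).2; split=> //; unlock FracField.tofrac.
rewrite -[LHS]FracField.pi_mul; apply/eqP.
rewrite piE /FracField.equivf /FracField.mulf /=.
by rewrite !numden_Ratio ?mulf_neq0 ?oner_neq0 // !mulr1 mulrC.
Qed.

(** Rational root argument: with c = n / d in lowest terms, clearing denominators in the monic
    equation shows that d divides n^s, so d is a constant. *)
Lemma fraction_poly_integral (k : fieldType) (c : {fraction {poly k}}) :
  integralOver (@FracField.tofrac {poly k}) c ->
  exists a : {poly k}, c = @FracField.tofrac {poly k} a.
Proof.
pose iota : {rmorphism {poly k} -> {fraction {poly k}}} :=
  @FracField.tofrac {poly k}.
have iota_inj : injective iota by move=> a b /eqP; rewrite tofrac_eq => /eqP.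
case=> q mon_q; rewrite -[map_poly _ q]/(map_poly iota q) => qc0.
have [n0 [d0 [d0nz]]] := fraction_quotient c.
rewrite -[_ * _]/(c * iota d0) -[RHS]/(iota n0) => cd0.
have [n [d [dnz cd cop]]] :
    exists n d : {poly k}, [/\ d != 0, c * iota d = iota n & coprimep d n].
  pose g := gcdp d0 n0.
  have gnz : g != 0 by rewrite gcdp_eq0 negb_and d0nz.
  exists (n0 %/ g), (d0 %/ g); split.
  - by rewrite dvdp_div_eq0 ?dvdp_gcdl.
  - apply: (mulIf (x := iota g)); first by rewrite tofrac_eq0.
    by rewrite -mulrA -!rmorphM /= !divpK ?dvdp_gcdl ?dvdp_gcdr.
  - by rewrite coprimep_div_gcd // d0nz.
pose s := (size q).-1.
have sq : size q = s.+1 by rewrite prednK // size_poly_gt0 monic_neq0.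
have E : \sum_(i < s.+1) q`_i * (n ^+ i * d ^+ (s - i)) = 0.
  apply: iota_inj; rewrite rmorph0 rmorph_sum /=.
  have := qc0; rewrite /root horner_coef size_map_poly_id0; last first.
    by rewrite (monicP mon_q) oner_eq0.
  rewrite sq => /eqP /(congr1 (fun z => z * iota d ^+ s)); rewrite mul0r.
  rewrite mulr_suml; apply: etrans; apply: eq_bigr => i _.
  rewrite coef_map !rmorphM !rmorphXn /= -cd exprMn -!mulrA; congr (_ * (_ * _)).
  by rewrite -exprD subnKC // -ltnS.
have dn : d %| n ^+ s.
  move/eqP: E; rewrite big_ord_recr /= subnn mulr1.
  have -> : q`_s = 1 by rewrite -(monicP mon_q) lead_coefE sq.
  rewrite mul1r addrC addr_eq0 => /eqP ->; rewrite dvdpNr.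
  elim/big_ind: _ => [||i _]; [exact: dvdp0 | exact: dvdp_add |].
  have -> : (s - i)%N = (s - i).-1.+1 by rewrite prednK // subn_gt0.
  by rewrite exprSr !mulrA dvdp_mulIr.
have := coprimepP _ _ (coprimep_expr s cop) d (dvdpp d) dn.
case/eqpP=> -[a b] /= /andP[a0 b0]; rewrite alg_polyC => ad.
have {}ad : d = (b / a)%:P.
  by rewrite -[d]scale1r -(mulVf a0) -scalerA ad -mul_polyC -polyCM mulrC.
exists ((a / b) *: n); apply: (mulIf (x := iota d)); first by rewrite tofrac_eq0.
rewrite cd -rmorphM /= ad mulrC mul_polyC scalerA.
by rewrite mulrA divfK ?divff ?scale1r.
Qed.

Lemma exists_splitting (F : fieldType) (p : {poly F}) m :
  p \is monic -> size p = m.+1 ->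
  exists (K : fieldType) (f : {rmorphism F -> K}) (v : 'I_m -> K),
    map_poly f p = \prod_(i < m) ('X - (v i)%:P).
Proof.
move=> mon_p sp; have [L [zs pE]] := exists_splits (monic_neq0 mon_p).
have {}pE : map_poly (in_alg L) p = \prod_(z <- zs) ('X - z%:P).
  apply/eqP; rewrite -eqp_monic //; last exact: monic_prod_XsubC.
  exact: monic_map.
have szs : size zs = m.
  have := congr1 (fun q : {poly L} => size q) pE.
  by rewrite size_map_poly sp size_prod_XsubC => -[].
exists L, (in_alg L), (fun i => zs`_i); rewrite pE (big_nth 0) szs.
by rewrite big_mkord.
Qed.

Lemma exists_root_ext (F : fieldType) (p : {poly F}) :
  (1 < size p)%N ->
  exists (K : fieldType) (f : {rmorphism F -> K}) (x : K), root (map_poly f p) x.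
Proof.
move=> p1; have pnz : p != 0 by rewrite -size_poly_gt0 ltnW.
have [L [zs pE]] := exists_splits pnz.
have : size (map_poly (in_alg L) p) = (size zs).+1.
  by rewrite (eqp_size pE) size_prod_XsubC.
rewrite size_map_poly => szs; case: zs => [|z zs] in pE szs.
  by rewrite szs in p1.
exists L, (in_alg L), z; rewrite (eqp_root pE).
by rewrite root_prod_XsubC mem_head.
Qed.

Lemma exists_nat_nonroot (F : fieldType) (q : {poly F}) :
  [pchar F] =i pred0 -> q != 0 -> exists c : nat, q.[c%:R] != 0.
Proof.
move=> F0 qnz; pose s := [seq c%:R : F | c <- iota 0 (size q)].
have /allPn[x /mapP[c _ ->] h] : ~~ all (root q) s; last by exists c.
apply/negP => roots_s.
have inj : injective (fun c : nat => c%:R : F).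
  move=> a b /eqP; wlog ab: a b / (a <= b)%N => [h|].
    by case/orP: (leq_total a b) => /h // h'; rewrite eq_sym => /h' ->.
  rewrite eq_sym -subr_eq0 -natrB // ((pcharf0P F).1 F0) subn_eq0 => ba.
  by apply/eqP; rewrite eqn_leq ab.
have : uniq s by rewrite map_inj_uniq ?iota_uniq.
by move/(max_poly_roots qnz roots_s); rewrite size_map size_iota ltnn.
Qed.

Lemma deriv_mul_root2 (F : fieldType) (a b : {poly F}) x :
  root a x -> root b x -> (a * b)^`().[x] = 0.
Proof.
by move=> /rootP ax /rootP bx; rewrite derivM !hornerE ax bx mulr0 mul0r addr0.
Qed.

(** Constant row operations that reduce [M] at [x] make at least two rows vanish there, so every
    term of the Leibniz expansion has two factors vanishing at [x]. *)
Lemma det_double_root (F : fieldType) m (M : 'M[{poly F}]_m) (x : F) :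
  (\rank (map_mx (horner_eval x) M) + 2 <= m)%N -> (\det M)^`().[x] = 0.
Proof.
set M0 := map_mx _ M; set r := \rank M0 => rm.
pose N := map_mx (@polyC F) (invmx (col_ebase M0)) *m M.
have r0 : (r < m)%N by lia.
have r1 : (r.+1 < m)%N by lia.
pose i := Ordinal r0; pose j := Ordinal r1.
have ij : j != i by rewrite -val_eqE /= neq_ltn ltnSn orbT.
have N0 (l l' : 'I_m) : (r <= l)%N -> root (N l l') x.
  move=> rl; have : map_mx (horner_eval x) N = pid_mx r *m row_ebase M0.
    rewrite map_mxM -map_mx_comp -/M0.
    have := congr1 (mulmx (invmx (col_ebase M0))) (mulmx_ebase M0).
    rewrite -mulmxA mulKmx ?col_ebase_unit // => ->; congr (_ *m _).
    by apply/matrixP => a b; rewrite mxE /= horner_evalE hornerC.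
  move/matrixP/(_ l l'); rewrite mxE horner_evalE => NE.
  apply/rootP; rewrite NE mxE big1 // => a _; rewrite mxE.
  by rewrite [(l < r)%N]ltnNge rl andbF mul0r.
suff : (\det N)^`().[x] = 0.
  rewrite det_mulmx det_map_mx derivM derivC mul0r add0r hornerM hornerC.
  move/eqP; rewrite mulf_eq0 => /orP[|/eqP //].
  rewrite -[_ == 0]negbK -unitfE -unitmxE.
  by rewrite unitmx_inv col_ebase_unit.
rewrite /determinant raddf_sum horner_sum big1 // => s _.
rewrite (bigD1 i) //= (bigD1 j) //= mulrCA.
apply: deriv_mul_root2; first exact: N0.
by apply/rootP; rewrite !hornerM (rootP (N0 j _ _)) ?mul0r ?mulr0 /=.
Qed.

(** * The discriminant *)

Section Discriminant.
Variable m : nat.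

Lemma psum_sym (A : comNzRingType) l :
  \sum_(i < m) 'X_i ^+ l \is @symmetric m A.
Proof.
apply/issymP => s; rewrite raddf_sum [RHS](reindex_inj (@perm_inj _ s)) /=.
by apply: eq_bigr => i _; rewrite rmorphXn /= /msym mmapXU.
Qed.

Definition psum_roots (A : comNzRingType) (T : {poly A}) l : A :=
  sval (symmetric_eval T (psum_sym A l)).

Lemma psum_rootsE (A : comNzRingType) (T : {poly A}) (R : idomainType)
  (f : {rmorphism A -> R}) (v : 'I_m -> R) l :
  map_poly f T = \prod_(i < m) ('X - (v i)%:P) ->
  f (psum_roots T l) = \sum_(i < m) v i ^+ l.
Proof.
move=> fT; rewrite /psum_roots; case: symmetric_eval => q /= /(_ _ _ _ fT) ->.
by rewrite raddf_sum; apply: eq_bigr => i _; rewrite /= rmorphXn /= mmapXU.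
Qed.

Definition hankel (A : comNzRingType) (T : {poly A}) : 'M[A]_m :=
  \matrix_(a, b) psum_roots T (a + b).

(* For [T] monic of degree [m] this is the discriminant of [T], as the Gram
   determinant of the power sums of its roots. *)
Definition disc (A : comNzRingType) (T : {poly A}) : A := \det (hankel T).

Definition vdm (R : comNzRingType) (v : 'I_m -> R) : R :=
  \det (Vandermonde m (\row_i v i)).

Lemma hankelE (A : comNzRingType) (T : {poly A}) (R : idomainType)
  (f : {rmorphism A -> R}) (v : 'I_m -> R) :
  map_poly f T = \prod_(i < m) ('X - (v i)%:P) ->
  map_mx f (hankel T)
  = Vandermonde m (\row_i v i) *m (Vandermonde m (\row_i v i))^T.
Proof.
move=> fT; apply/matrixP => a b; rewrite !mxE (psum_rootsE _ fT).
by apply: eq_bigr => i _; rewrite !mxE exprD.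
Qed.

Lemma discE (A : comNzRingType) (T : {poly A}) (R : idomainType)
  (f : {rmorphism A -> R}) (v : 'I_m -> R) :
  map_poly f T = \prod_(i < m) ('X - (v i)%:P) -> f (disc T) = vdm v ^+ 2.
Proof.
by move=> fT; rewrite /disc -det_map_mx (hankelE fT) det_mulmx det_tr.
Qed.

Lemma vdm_inj (R : comNzRingType) (v : 'I_m -> R) : vdm v != 0 -> injective v.
Proof.
move=> vnz i j vij; apply: contraNeq vnz => ij.
rewrite /vdm -det_tr (determinant_alternate ij) // => a.
by rewrite !mxE vij.
Qed.

Lemma rank_Vandermonde (F : fieldType) (v : 'I_m -> F) :
  (\rank (Vandermonde m (\row_i v i)) <= size (undup (codom v)))%N.
Proof.
set s := undup _; pose A := \matrix_(a < m, c < size s) (s`_c) ^+ a.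
pose B := \matrix_(c < size s, i < m) (v i == s`_c)%:R : 'M[F]_(_, _).
suff -> : Vandermonde m (\row_i v i) = A *m B by exact: mulmx_max_rank.
apply/matrixP => a i; rewrite !mxE.
have vs : v i \in s by rewrite mem_undup codom_f.
have ls : (index (v i) s < size s)%N by rewrite index_mem.
rewrite (bigD1 (Ordinal ls)) //= !mxE /= nth_index // eqxx mulr1 big1 ?addr0 //.
move=> c cs; rewrite !mxE; case: eqP => [E|]; rewrite ?mulr0 //.
case/eqP: cs; apply: val_inj => /=.
by rewrite E index_uniq // undup_uniq.
Qed.

(** At [y] the Hankel matrix is a Vandermonde matrix times its transpose, of rank at most the number
    of distinct roots; with at most m - 2 of these, the derivative of its determinant would
    vanish. *)
Lemma disc_simple_root (k K : fieldType) (h : {rmorphism k -> K}) (y : K)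
  (T : {poly {poly k}}) (w : 'I_m -> K) :
  map_poly (horner_eval y \o map_poly h) T = \prod_(i < m) ('X - (w i)%:P) ->
  (map_poly h (disc T))^`().[y] != 0 -> (m <= (size (undup (codom w))).+1)%N.
Proof.
move=> gT D'nz; apply: contraR D'nz; rewrite -ltnNge => lt_m.
rewrite /disc -det_map_mx; apply/eqP/det_double_root.
rewrite -map_mx_comp (hankelE gT); apply: leq_trans lt_m.
by rewrite addn2 !ltnS (leq_trans (mxrankM_maxl _ _)) // rank_Vandermonde.
Qed.

(** At most one pair of indices has a common value under [w], so a nontrivial [s] preserving the
    fibres can only exchange this pair. *)
Lemma tperm_of_fiber (T : eqType) (w : 'I_m -> T) (s : 'S_m) :
  (m <= (size (undup (codom w))).+1)%N ->
  (forall i, w (s i) = w i) -> s != 1%g ->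
  exists i j, i != j /\ s = tperm i j.
Proof.
move=> hm ws s1; have [a sa] : exists a, s a != a.
  apply/existsP; apply: contraR s1; rewrite negb_exists => /forallP h.
  by apply/eqP/permP => i; rewrite perm1; apply/eqP; move: (h i); rewrite negbK.
set b := s a in sa.
(* Given a collision [w c = w d], the indices other than [c] already realize all values of [w]; by
   counting, [w] is injective on them. *)
have inj c d i j : c != d -> w c = w d -> i != c -> j != c ->
    w i = w j -> i = j.
  move=> cd wcd ic jc; pose t := rem c (enum 'I_m).
  have st : size (map w t) = m.-1.
    by rewrite size_map size_rem ?mem_enum // size_enum_ord.
  have ut : uniq (map w t).
    apply: (@leq_size_uniq _ (undup (codom w))); first exact: undup_uniq.
      move=> x; rewrite mem_undup => /codomP[i' ->].
      have [->|i'c] := eqVneq i' c; first rewrite wcd.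
        by apply: map_f; rewrite mem_rem_uniq ?enum_uniq // !inE eq_sym cd mem_enum.
      by apply: map_f; rewrite mem_rem_uniq ?enum_uniq // !inE i'c mem_enum.
    by rewrite st -ltnS prednK // (leq_ltn_trans _ (ltn_ord a)).
  have it x : x != c -> x \in t.
    by move=> xc; rewrite mem_rem_uniq ?enum_uniq // !inE xc mem_enum.
  move=> wij; have /eqP := congr1 (fun x => index x (map w t)) wij.
  have idx x : x != c -> index (w x) (map w t) = index x t.
    move=> xc; have lx : (index x t < size t)%N by rewrite index_mem it.
    rewrite -{1}(nth_index a (it x xc)) -(nth_map _ (w a)) // index_uniq //.
    by rewrite size_map.
  rewrite !idx // => /eqP eij.
  by rewrite -(nth_index a (it i ic)) eij nth_index // it.
exists a, b; split; first by rewrite eq_sym.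
have wab : w b = w a by rewrite /b ws.
apply/permP => i; case: tpermP => [->|->|] //.
  apply: contraTeq isT => sba.
  have := inj b a (s b) a; rewrite ws wab.
  have sbb : s b != b by rewrite (inj_eq perm_inj).
  by move/(_ sa erefl sbb); rewrite eq_sym sa => /(_ isT erefl) /eqP; rewrite (negbTE sba).
move=> /eqP ia /eqP ib; have [sia|sia] := eqVneq (s i) a.
  have wi : w i = w b by rewrite wab -sia ws.
  have := inj a b i b; rewrite eq_sym sa => /(_ isT (esym wab) ia isT wi).
  by move/eqP; rewrite (negbTE ib).
have := inj a b (s i) i; rewrite eq_sym sa ws.
by move=> /(_ isT (esym wab) sia ia erefl).
Qed.

End Discriminant.

(** * Inertia at a simple zero of the discriminant *)

(** In characteristic 0, finitely many proper kernels cannot cover [V]. As [V] carries no scalars,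
    [z] is added [c] times for a natural number [c] avoiding the roots of finitely many nonzero
    polynomials. *)
Lemma exists_nat_comb (F : fieldType) (V : zmodType) (J : eqType) (s : seq J)
  (phi : J -> {additive V -> F}) :
  [pchar F] =i pred0 ->
  (forall j, exists x, phi j x != 0) ->
  exists x, forall j, j \in s -> phi j x != 0.
Proof.
move=> F0 hphi; elim: s => [|j s [x IHs]]; first by exists 0.
have [z zj] := hphi j.
pose q i := (phi i x)%:P + (phi i z)%:P * 'X.
have qnz i : i \in j :: s -> q i != 0.
  move=> ijs; apply/negP => /eqP qi.
  have E c : phi i x + phi i z * c = 0.
    by have := congr1 (fun q => q.[c]) qi; rewrite /q !hornerE.
  have xi0 : phi i x = 0 by have := E 0; rewrite mulr0 addr0.
  have zi0 : phi i z = 0 by have := E 1; rewrite mulr1 xi0 add0r.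
  move: ijs; rewrite inE => /orP[/eqP ij|/IHs]; last by rewrite xi0 eqxx.
  by rewrite -ij zi0 eqxx in zj.
have [|c cnz] := exists_nat_nonroot (q := \prod_(i <- j :: s) q i) F0.
  by rewrite prodf_seq_neq0; apply/allP => i /qnz.
exists (x + z *+ c) => i ijs.
move: cnz; rewrite horner_prod prodf_seq_neq0 => /allP/(_ i ijs) /=.
by rewrite /q !hornerE raddfD raddfMn /= mulr_natr.
Qed.

Section Transposition.
Variable m : nat.

(** Independence of characters: if the sums vanished on all monomials they would vanish on all
    polynomials, but the product of the [fac i] isolates [i0]. *)
Lemma exists_separating_monomial (F : fieldType) (I : finType) (A : {pred I})
  (x : I -> 'I_m -> F) (c : I -> F) (i0 : I) :
  i0 \in A -> c i0 != 0 ->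
  (forall i, i \in A -> i != i0 -> exists l, x i l != x i0 l) ->
  exists u : 'X_{1..m}, \sum_(i in A) c i * mmap1 (x i) u != 0.
Proof.
move=> Ai0 ci0 sep; apply: Classical_Prop.NNPP => h.
have {}h u : \sum_(i in A) c i * mmap1 (x i) u = 0.
  by apply/eqP/negPn/negP => hu; apply: h; exists u.
have hP (P : {mpoly F[m]}) : \sum_(i in A) c i * mmap idfun (x i) P = 0.
  under eq_bigr do rewrite /mmap big_distrr.
  rewrite exchange_big /= big1 // => u _.
  under eq_bigr do rewrite mulrCA.
  by rewrite -big_distrr /= h mulr0.
(* The default 1 is taken when [x i] and [x i0] agree everywhere, which within [A] happens only for
   [i = i0]. *)
pose fac i : {mpoly F[m]} :=
  if [pick l | x i l != x i0 l] is Some l then 'X_l - (x i l)%:MP else 1.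
have fac_i i : i \in A -> i != i0 -> mmap idfun (x i) (fac i) = 0.
  move=> iA ii0; rewrite /fac; case: pickP => [l _|no].
    by rewrite rmorphB /= mmapXU mmapC subrr.
  by have [l] := sep i iA ii0; rewrite no.
have fac_i0 i : mmap idfun (x i0) (fac i) != 0.
  rewrite /fac; case: pickP => [l|_]; last by rewrite rmorph1 oner_neq0.
  by rewrite rmorphB /= mmapXU mmapC subr_eq0 eq_sym.
have := hP (\prod_(i in A | i != i0) fac i).
rewrite (bigD1 i0) //= [X in _ + X]big1 ?addr0; last first.
  by move=> i ii; rewrite rmorph_prod (bigD1 i) //= fac_i ?mul0r ?mulr0; case/andP: ii.
move/eqP; rewrite mulf_eq0 (negbTE ci0) /= rmorph_prod prodf_seq_eq0.
by case/hasP=> i _ /andP[_]; rewrite /= (negbTE (fac_i0 i)).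
Qed.

Lemma vdm_morph (R S : comNzRingType) (f : {rmorphism R -> S}) (v : 'I_m -> R) :
  f (vdm v) = vdm (f \o v).
Proof.
rewrite /vdm -det_map_mx; congr (\det _); apply/matrixP => a b.
by rewrite !mxE rmorphXn.
Qed.

Lemma vdm_perm (R : comNzRingType) (v : 'I_m -> R) (s : 'S_m) :
  vdm (fun i => v (s i)) = (-1) ^+ s * vdm v.
Proof.
rewrite /vdm; have -> : Vandermonde m (\row_i v (s i))
    = col_perm s (Vandermonde m (\row_i v i)).
  by apply/matrixP => a b; rewrite !mxE.
by rewrite col_permE det_mulmx det_perm odd_permV mulrC.
Qed.

(* If no nontrivial element of
   [H] fixed [w], the characters [h |-> h (w o r o s)], [s] in [H], would be
   independent, and [vdm v * \sum_s sgn s * h (v o s)] would have square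
   [D * u] with [u] a unit. *)
Lemma exists_tperm_of_simple_root (A : comNzRingType) (T : {poly A})
  (R : idomainType) (K : fieldType)
  (f : {rmorphism A -> R}) (g : {rmorphism A -> K})
  (v : 'I_m -> R) (w : 'I_m -> K) (H : {group 'S_m}) :
  [pchar K] =i pred0 -> injective f ->
  map_poly f T = \prod_(i < m) ('X - (v i)%:P) ->
  map_poly g T = \prod_(i < m) ('X - (w i)%:P) ->
  (forall P : {mpoly A[m]},
     (forall s, s \in H -> mmap f v (msym s P) = mmap f v P) ->
     exists a, mmap f v P = f a) ->
  (m <= (size (undup (codom w))).+1)%N ->
  (forall a b : A, a ^+ 2 = disc m T * b -> g b = 0) ->
  exists i j, i != j /\ tperm i j \in H.
Proof.
move=> K0 f_inj fT gT inv hw simple; apply: Classical_Prop.NNPP => no_tperm.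
pose phi0 (r : 'S_m) (h : {mpoly A[m]}) : K :=
  \sum_(s in H) (-1) ^+ s * mmap g (fun i => w (r (s i))) h.
have phi_add r : zmod_morphism (phi0 r).
  move=> x z; rewrite /phi0 -sumrB; apply: eq_bigr => s _.
  by rewrite raddfB mulrBr.
pose phi r : {additive {mpoly A[m]} -> K} :=
  HB.pack (phi0 r) (GRing.isZmodMorphism.Build _ _ _ (phi_add r)).
(* The order [r] in which the roots specialize is only known at the end, so [h] is chosen to suit
   all [r] at once. *)
have [r|h hnz] := exists_nat_comb (phi := phi) (enum 'S_m) K0.
  have [|||u hu] := @exists_separating_monomial K 'S_m H
    (fun s i => w (r (s i))) (fun s => (-1) ^+ s) 1%g.
  - exact: group1.
  - by rewrite signr_eq0.
  (* If [s] could not be separated from 1, its conjugate by [r] would preserve [w], hence be a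
     transposition, and so would [s]. *)
  - move=> s sH s1; apply: Classical_Prop.NNPP => sep.
    have fixw i : w (((s ^ r)%g) i) = w i.
      rewrite conjgE !permM; apply/eqP/negPn/negP => hi; apply: sep.
      by exists ((r^-1)%g i); rewrite perm1 permKV.
    have [|i [j [ij sE]]] := tperm_of_fiber hw fixw.
      by rewrite conjg_eq1.
    apply: no_tperm; exists ((r^-1)%g i), ((r^-1)%g j); split.
      by rewrite (inj_eq perm_inj).
    by rewrite -tpermJ -sE conjgK.
  exists 'X_[u]; apply: contra hu => /eqP hu; apply/eqP; rewrite -[RHS]hu /=.
  by apply: eq_bigr => s _; rewrite mmapX.
(* [P1] and [V] are both alternating under [H], so [V * P1] and [P1 ^+ 2] take values coming from
   some [b] and [u] in [A], with b^2 = disc u. Then [simple] gives [g u = 0], although [g u] is the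
   square of a nonzero [phi r h]. *)
pose P1 : {mpoly A[m]} := \sum_(s in H) (-1) ^+ s *: msym s h.
pose V : {mpoly A[m]} := vdm (fun i => 'X_i).
have symP1 s : s \in H -> msym s P1 = (-1) ^+ s *: P1.
  move=> sH; rewrite raddf_sum scaler_sumr.
  rewrite [RHS](reindex_inj (mulIg s)) /=.
  apply: eq_big => [t|t tH]; first by rewrite groupMr.
  rewrite msymZ scalerA odd_permM signr_addb mulrC -mulrA -signr_addb addbb mulr1.
  congr (_ *: _); apply/mpolyP => u; rewrite !mcoeff_sym; congr (_@_ _).
  by apply/mnmP => i; rewrite !mnmE permM.
have symV s : msym s V = (-1) ^+ s *: V.
  rewrite scaler_sign -mulr_sign /V vdm_morph -vdm_perm; congr (\det _); apply/matrixP => a b.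
  by rewrite !mxE /= /msym mmapXU.
have [b hb] : exists b, mmap f v (V * P1) = f b.
  apply: inv => s sH; rewrite msymM symP1 // symV -scalerAl -scalerAr scalerA.
  by rewrite -signr_addb addbb scale1r.
have [u hu] : exists u, mmap f v (P1 ^+ 2) = f u.
  apply: inv => s sH; by rewrite rmorphXn /= symP1 // exprZn sqrr_sign scale1r.
have [r gu] := mpoly_specialize f_inj fT gT hu.
have : g u = 0.
  apply: (simple b); apply: f_inj; rewrite rmorphXn rmorphM /= -hb -hu.
  rewrite (discE fT) rmorphM exprMn rmorphXn /=; congr (_ ^+ 2 * _).
  rewrite vdm_morph; congr (\det _); apply/matrixP => i j.
  by rewrite !mxE /= mmapXU.
apply/eqP; rewrite gu rmorphXn expf_eq0 /=.
have := hnz r (mem_enum _ _); congr (_ != 0).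
rewrite /= /phi0 raddf_sum; apply: eq_bigr => t _.
by rewrite /= mmapZ rmorphXn rmorphN1 mmap_msym.
Qed.

End Transposition.

(** * The Tutte polynomial at an arbitrary value of y *)

(** Here [y] is any ring element instead of an indeterminate, so that a ring morphism carries [geo]
    and [tut] at [y] to the same expressions at its image. *)
Definition geo (R : nzRingType) j (y : R) : R := \sum_(0 <= i < j) y ^+ i.

Definition tut (R : nzRingType) m j (y : R) : {poly R} :=
  'X^m + (y%:P + \sum_(1 <= i < m) 'X^i) * (geo j y)%:P.

Lemma tutte_CE (R : nzRingType) n j : tutte_C R n j = tut (n - 1) j 'X.
Proof.
rewrite /tutte_C /tut /geo rmorph_sum; congr (_ + _ * _).
by apply: eq_bigr => i _; rewrite rmorphXn.
Qed.

Lemma geo_morph (R S : nzRingType) (f : {rmorphism R -> S}) j y :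
  f (geo j y) = geo j (f y).
Proof. by rewrite /geo rmorph_sum; apply: eq_bigr => i _; rewrite rmorphXn. Qed.

Lemma tut_morph (R S : nzRingType) (f : {rmorphism R -> S}) m j y :
  map_poly f (tut m j y) = tut m j (f y).
Proof.
rewrite /tut rmorphD rmorphM rmorphD /= map_polyXn !map_polyC /= geo_morph.
rewrite rmorph_sum; congr (_ + (_ + _) * _).
by apply: eq_bigr => i _; rewrite /= map_polyXn.
Qed.

Lemma geoX1 (R : comNzRingType) j (y : R) : (y - 1) * geo j y = y ^+ j - 1.
Proof. by rewrite subrX1 /geo big_mkord. Qed.

Lemma horner_geo (R : comNzRingType) j (y : R) : (geo j 'X).[y] = geo j y.
Proof.
rewrite /geo horner_sum; apply: eq_bigr => i _; exact: hornerXn.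
Qed.

Lemma size_geo (R : nzRingType) j : size (geo j 'X : {poly R}) = j.
Proof.
have -> : geo j 'X = \poly_(i < j) (1 : R).
  by rewrite /geo big_mkord poly_def; apply: eq_bigr => i _; rewrite scale1r.
case: j => [|j]; first by rewrite poly_def big_ord0 size_poly0.
by rewrite size_poly_eq ?oner_neq0.
Qed.

(** Differentiating (y - 1) J = y^j - 1 at [z] gives (z - 1) J'(z) = j z^(j-1), which is nonzero. *)
Lemma geo_root_simple (R : idomainType) j (z : R) :
  j%:R != 0 :> R -> geo j z = 0 -> z != 0 /\ (geo j 'X)^`().[z] != 0.
Proof.
move=> jnz gz; have znz : z != 0.
  apply: contra_eq_neq gz => ->; rewrite /geo.
  case: j jnz => [|j _]; first by rewrite eqxx.
  rewrite big_nat_recl // expr0 big1 ?addr0 ?oner_neq0 // => i _.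
  by rewrite exprS mul0r.
split=> //; have /(congr1 (fun q => q^`().[z])) := geoX1 j ('X : {poly R}).
rewrite derivM !derivB derivX derivC derivXn subr0 mul1r subr0 !hornerE.
rewrite horner_geo gz add0r hornerMn hornerXn => E.
apply: contraNneq jnz => g0; move/eqP: E; rewrite g0 mulr0 eq_sym -mulr_natl.
by rewrite mulf_eq0 expf_eq0 (negbTE znz) andbF orbF.
Qed.

Lemma horner_tut (R : comNzRingType) m j (y x : R) :
  (tut m j y).[x] = x ^+ m + (y + \sum_(1 <= i < m) x ^+ i) * geo j y.
Proof.
rewrite /tut !hornerE horner_sum; congr (_ + (_ + _) * _).
by apply: eq_bigr => i _; rewrite hornerXn.
Qed.

Lemma tut_at0 (R : comNzRingType) m j (y : R) :
  (0 < m)%N -> (tut m j y).[0] = y * geo j y.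
Proof.
move=> m0; rewrite horner_tut big_nat big1 => [|i /andP[i1 _]].
  by rewrite addr0 expr0n eqn0Ngt m0 add0r.
by rewrite expr0n eqn0Ngt i1.
Qed.

Lemma tut_at1 (R : comNzRingType) m j (y : R) :
  (0 < m)%N -> (tut m j y).[1] = y ^+ j + m%:R * geo j y.
Proof.
move=> m0; rewrite horner_tut expr1n.
under eq_bigr do rewrite expr1n.
rewrite sumr_const_nat natrB // -[y ^+ j](subrK 1) -geoX1; ring.
Qed.

Lemma tut_monic_size (R : comNzRingType) m j (y : R) : (0 < m)%N ->
  tut m j y \is monic /\ size (tut m j y) = m.+1.
Proof.
move=> m0; rewrite /tut; set p := _ * _.
have sp : (size p < size ('X^m : {poly R}))%N.
  rewrite size_polyXn ltnS /p mulrC mul_polyC.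
  rewrite (leq_trans (size_scale_leq _ _)) // (leq_trans (size_polyD _ _)) //.
  rewrite geq_max (leq_trans (size_polyC_leq1 _)) //= big_nat.
  elim/big_ind: _ => [|a b sa sb|i /andP[_ im]]; first by rewrite size_poly0.
    by rewrite (leq_trans (size_polyD _ _)) // geq_max sa.
  by rewrite size_polyXn.
split; last by rewrite size_polyDl // size_polyXn.
by rewrite monicE lead_coefDl // lead_coefXn.
Qed.

Section Roots.
Variables (R : idomainType) (m j : nat) (y : R) (v : 'I_m -> R).
Hypothesis tutE : tut m j y = \prod_(i < m) ('X - (v i)%:P).

Lemma prod_tut_roots x :
  \prod_(i < m) (v i - x) = (-1) ^+ m * (tut m j y).[x].
Proof.
rewrite tutE horner_prod; have -> : (-1) ^+ m = \prod_(i < m) (-1 : R).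
  by rewrite prodr_const card_ord.
by rewrite -big_split; apply: eq_bigr => i _; rewrite /= !hornerE mulN1r opprB.
Qed.

Lemma prod_tut_roots0 :
  (0 < m)%N -> \prod_(i < m) v i = (-1) ^+ m * (y * geo j y).
Proof.
move=> m0; rewrite -(tut_at0 j y m0) -prod_tut_roots.
by apply: eq_bigr => i _; rewrite subr0.
Qed.

Lemma deriv_tut_root i :
  (tut m j y)^`().[v i] = \prod_(l < m | l != i) (v i - v l).
Proof.
rewrite tutE (bigD1 i) //= derivM derivXsubC mul1r !hornerE subrr mul0r addr0.
by rewrite horner_prod; apply: eq_bigr => l _; rewrite !hornerE.
Qed.

(** Each unordered pair contributes minus the square of its difference. The sign is left
    existential, since only zeros and their orders matter later. *)
Lemma prod_diff_vdm :
  exists b : bool,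
    \prod_(i < m) \prod_(l < m | l != i) (v i - v l) = (-1) ^+ b * vdm v ^+ 2.
Proof.
rewrite /vdm det_Vandermonde.
pose F i l := v l - v i.
have -> : \prod_(i < m) \prod_(l < m | (i < l)%N)
    ((\row_a v a) 0 l - (\row_a v a) 0 i) = \prod_(i < m) \prod_(l < m | (i < l)%N) F i l.
  by apply: eq_bigr => i _; apply: eq_bigr => l _; rewrite !mxE.
have -> : \prod_(i < m) \prod_(l < m | l != i) (v i - v l)
   = (\prod_(i < m) \prod_(l < m | (i < l)%N) (- F i l))
     * \prod_(i < m) \prod_(l < m | (l < i)%N) F l i.
  rewrite -big_split; apply: eq_bigr => i _ /=.
  rewrite [LHS](bigID (fun l : 'I_m => (i < l)%N)) /=. congr (_ * _).
    apply: eq_big => l; last by rewrite /F opprB.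
    by rewrite -val_eqE /=; case: ltngtP.
  by apply: eq_bigl => l; rewrite -val_eqE /=; case: ltngtP.
rewrite [X in _ * X](exchange_big_dep xpredT) //=.
set P := \prod_(i < m) \prod_(l < m | _) F i l.
suff [b ->] : exists b : bool,
    \prod_(i < m) \prod_(l < m | (i < l)%N) (- F i l) = (-1) ^+ b * P.
  by exists b; rewrite -mulrA.
rewrite /P; elim/big_ind2: _ => [|x1 x2 y1 y2 [b1 ->] [b2 ->]|i _].
- by exists false; rewrite mulr1.
- by exists (b1 (+) b2); rewrite signr_addb mulrACA.
elim/big_ind2: _ => [|x1 x2 y1 y2 [b1 ->] [b2 ->]|l _].
- by exists false; rewrite mulr1.
- by exists (b1 (+) b2); rewrite signr_addb mulrACA.
by exists true; rewrite expr1 mulN1r.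
Qed.

End Roots.

(* [x * T' - m * T = - J * g] for [T = tut m j y], [J = geo j y],
   [g = euler m y x]. *)
Definition euler (R : nzRingType) m (y x : R) : R :=
  m%:R * y + \sum_(1 <= i < m) (m - i)%:R * x ^+ i.

(** The operator x d/dx - m kills x^m, so only multiples of J remain. *)
Lemma euler_tut (R : comNzRingType) m j (y x : R) : (0 < m)%N ->
  x * (tut m j y)^`().[x] - m%:R * (tut m j y).[x] = - (geo j y * euler m y x).
Proof.
move=> m0; rewrite horner_tut /tut derivD derivM derivC mulr0 addr0 derivD derivC.
rewrite add0r derivXn raddf_sum /= !hornerE horner_sum /euler.
set S := \sum_(1 <= i < m) x ^+ i.
set S' := \sum_(1 <= i < m) (m - i)%:R * _; set S1 := \sum_(1 <= i < m) _.
have -> : S' = m%:R * S - x * S1.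
  rewrite /S' /S /S1 !mulr_sumr -sumrB !big_nat; apply: eq_bigr => i /andP[i1 im].
  rewrite derivXn hornerMn hornerXn -(mulr_natl (x ^+ i.-1)) mulrCA -exprS prednK //.
  by rewrite natrB 1?ltnW // mulrBl.
rewrite hornerMn hornerXn -(mulr_natl _ m) -[in x ^+ m](prednK m0) exprS; ring.
Qed.

(** * The zeros of the discriminant modulo p *)

Section EulerResultant.
Variable m : nat.

Lemma euler_sym (A : comNzRingType) (y : A) :
  \prod_(i < m) euler m y%:MP 'X_i \is @symmetric m A.
Proof.
apply/issymP => s; rewrite rmorph_prod [RHS](reindex_inj (@perm_inj _ s)) /=.
apply: eq_bigr => i _; rewrite /euler rmorphD rmorphM rmorph_nat rmorph_sum /=.
rewrite {1}/msym mmapC; congr (_ + _); apply: eq_bigr => l _.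
by rewrite rmorphM rmorph_nat rmorphXn /= /msym mmapXU.
Qed.

(* The resultant in [x] of [tut m j 'X] and [euler m 'X x]. *)
Definition eulres j : {poly int} :=
  sval (symmetric_eval (tut m j ('X : {poly int})) (euler_sym 'X)).

Lemma eulresE j (R : idomainType) (f : {rmorphism {poly int} -> R})
  (v : 'I_m -> R) :
  tut m j (f 'X) = \prod_(i < m) ('X - (v i)%:P) ->
  f (eulres j) = \prod_(i < m) euler m (f 'X) (v i).
Proof.
move=> fT; rewrite /eulres; case: symmetric_eval => q /= /(_ R f v) ->.
  rewrite rmorph_prod; apply: eq_bigr => i _ /=.
  rewrite /euler rmorphD rmorphM rmorph_nat rmorph_sum /= mmapC; congr (_ + _).
  by apply: eq_bigr => l _; rewrite rmorphM rmorph_nat rmorphXn /= mmapXU.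
by rewrite tut_morph.
Qed.

Lemma exists_tut_roots j (F : fieldType) (y : F) : (0 < m)%N ->
  exists (K : fieldType) (h : {rmorphism F -> K}) (v : 'I_m -> K),
    tut m j (h y) = \prod_(i < m) ('X - (v i)%:P).
Proof.
move=> m0; have [mon_T sT] := tut_monic_size j y m0.
have [K [h [v hv]]] := exists_splitting mon_T sT.
by exists K, h, v; rewrite -tut_morph.
Qed.

Lemma geo_neq0 (F : idomainType) j : (0 < j)%N -> geo j 'X != 0 :> {poly F}.
Proof. by move=> j0; rewrite -size_poly_gt0 size_geo. Qed.

(** Multiply v_i T'(v_i) = - J euler(v_i) over all roots: the v_i have product +- y J, the T'(v_i)
    have product +- D, and one factor J cancels. *)
Lemma disc_eulres j : (0 < m)%N -> (0 < j)%N ->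
  exists b : bool, 'X * disc m (tut m j 'X)
                   = (-1) ^+ b * geo j 'X ^+ m.-1 * eulres j :> {poly int}.
Proof.
move=> m0 j0; pose iota : {rmorphism {poly int} -> {fraction {poly int}}} :=
  @FracField.tofrac {poly int}.
have [K [h [v vE]]] := exists_tut_roots j (iota 'X) m0.
pose f : {rmorphism {poly int} -> K} := h \o iota.
have f_inj : injective f.
  move=> a b /fmorph_inj /eqP; rewrite tofrac_eq; exact: eqP.
have vE' : tut m j (f 'X) = \prod_(i < m) ('X - (v i)%:P) by [].
have [b hb] := prod_diff_vdm v.
exists b; apply: (f_inj); rewrite !rmorphM !rmorphXn rmorphN1 geo_morph.
rewrite (eulresE vE') (@discE m _ _ _ f v); last by rewrite tut_morph.
have Jnz : geo j (f 'X) != 0.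
  by rewrite -geo_morph -(rmorph0 f) (inj_eq f_inj) geo_neq0.
have prod_v := prod_tut_roots0 vE' m0.
have prodE : \prod_(i < m) v i * \prod_(i < m) \prod_(l < m | l != i) (v i - v l)
    = (- geo j (f 'X)) ^+ m * \prod_(i < m) euler m (f 'X) (v i).
  have -> : (- geo j (f 'X)) ^+ m = \prod_(i < m) - geo j (f 'X).
    by rewrite prodr_const card_ord.
  rewrite -!big_split; apply: eq_bigr => i _ /=.
  have vi0 : (tut m j (f 'X)).[v i] = 0.
    by rewrite vE' horner_prod (bigD1 i) //= hornerXsubC subrr mul0r.
  by rewrite -(deriv_tut_root vE') mulNr -euler_tut // vi0 mulr0 subr0.
have cnz : (-1) ^+ m * (-1) ^+ b * geo j (f 'X) != 0.
  by rewrite !mulf_neq0 ?signr_eq0.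
apply: (mulfI cnz).
transitivity ((-1) ^+ m * (f 'X * geo j (f 'X)) * ((-1) ^+ b * vdm v ^+ 2)).
  by ring.
rewrite -hb -prod_v prodE (exprNn (geo j (f 'X))).
have -> : geo j (f 'X) ^+ m = geo j (f 'X) * geo j (f 'X) ^+ m.-1.
  by rewrite -exprS prednK.
have bb : (-1) ^+ b * (-1) ^+ b = 1 :> K by rewrite -signr_addb addbb.
rewrite -[LHS]mul1r -[X in X * _ = _]bb; ring.
Qed.

(** At a zero of J the polynomial collapses to x^m, all of whose roots are 0. Thus in characteristic
    0 a nonzero root of the resultant is not a root of J. *)
Lemma eulres_geo_root j (K : fieldType) (f : {rmorphism {poly int} -> K}) :
  (0 < m)%N -> geo j (f 'X) = 0 -> f (eulres j) = (m%:R * f 'X) ^+ m.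
Proof.
move=> m0 g0; have tE : tut m j (f 'X) = \prod_(i < m) ('X - 0%:P).
  by rewrite /tut g0 polyC0 mulr0 addr0 subr0 prodr_const card_ord.
rewrite (eulresE (v := fun=> 0) tE) prodr_const card_ord; congr (_ ^+ _).
rewrite /euler big_nat big1 ?addr0 // => i /andP[i1 _].
by rewrite expr0n eqn0Ngt i1 mulr0.
Qed.

(** As m = 0 in [R], [euler] is - x times the derivative of 1 + x + ... + x^(m-1) = (x - 1)^(m-1),
    and - (m - 1) = 1. *)
Lemma euler_pchar (R : idomainType) p e (y x : R) :
  p \in [pchar R] -> m = (p ^ e)%N -> (1 < m)%N ->
  euler m y x = x * (x - 1) ^+ (m - 2).
Proof.
move=> pR mE m1; have m0 : m%:R = 0 :> R.
  rewrite mE natrX; case: e mE m1 => [->|e _ _]; first by rewrite expn0.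
  by rewrite exprS pcharf0 // mul0r.
have pP : p \in [pchar {poly R}] by rewrite pchar_poly.
have geoE : geo m 'X = ('X - 1) ^+ m.-1 :> {poly R}.
  have nz : 'X - 1 != 0 :> {poly R} by rewrite polyXsubC_eq0.
  apply: (mulfI nz); rewrite geoX1 -exprS prednK 1?ltnW //.
  rewrite -{1}['X](subrK 1) exprDn_pchar ?expr1n ?addrK //.
  by rewrite mE pnatX pnatE ?pP // (pcharf_prime pR).
have := congr1 (fun q => q^`().[x]) geoE.
rewrite deriv_exp derivB derivX derivC subr0 mul1r hornerMn !hornerE /euler m0.
rewrite mul0r add0r {1}/geo (big_ltn (ltnW m1)) derivD hornerD raddf_sum /= horner_sum.
rewrite expr0 -polyC1 derivC horner0 add0r.
have -> : \sum_(1 <= i < m) (m - i)%:R * x ^+ i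
    = - (x * \sum_(1 <= i < m) ('X^i)^`().[x]).
  rewrite mulr_sumr -sumrN !big_nat; apply: eq_bigr => i /andP[i1 im].
  rewrite derivXn hornerMn hornerXn -(mulr_natl (x ^+ i.-1)) mulrCA -exprS.
  by rewrite prednK // natrB 1?ltnW // m0 sub0r mulNr.
have m1E : m.-1%:R = -1 :> R by rewrite -subn1 natrB 1?ltnW // m0 sub0r.
by move=> ->; rewrite -mulr_natl m1E mulN1r mulrN opprK subn2.
Qed.

(** By [euler_pchar] the resultant is the product of the v_i times the (m-2)-th power of the product
    of the v_i - 1. These products are +- y J and +- T(1) = +- y^j, and the signs cancel. *)
Lemma eulres_pchar j p e : prime p -> m = (p ^ e)%N -> (1 < m)%N ->
  map_poly (intr : int -> 'F_p) (eulres j)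
  = geo j 'X * 'X ^+ (j * (m - 2)).+1.
Proof.
move=> p_pr mE m1; have m0 := ltnW m1.
pose iota : {rmorphism {poly 'F_p} -> {fraction {poly 'F_p}}} :=
  @FracField.tofrac {poly 'F_p}.
have [K [h [v vE]]] := exists_tut_roots j (iota 'X) m0.
pose f : {rmorphism {poly int} -> K} := h \o (iota \o map_poly intr).
have fX : f 'X = h (iota 'X) by rewrite /f /= map_polyX.
have f_inj : injective (h \o iota).
  move=> a b /fmorph_inj /eqP; rewrite tofrac_eq; exact: eqP.
apply: (f_inj); rewrite -[LHS]/(f (eulres j)) (@eulresE j K f v) fX //.
rewrite /= !rmorphM !rmorphXn !geo_morph /=; set y := h (iota 'X) in vE *.
have pK : p \in [pchar K].
  apply: (rmorph_pchar (h \o iota)); rewrite pchar_poly; exact: pchar_Fp.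
have mK : m%:R = 0 :> K.
  rewrite mE natrX; case: e mE m1 => [->|e _ _]; first by rewrite expn0.
  by rewrite exprS pcharf0 // mul0r.
under eq_bigr do rewrite (euler_pchar _ _ pK mE m1).
rewrite big_split prodrXl /=.
rewrite (prod_tut_roots0 vE) // (prod_tut_roots vE) tut_at1 // mK mul0r addr0.
have sgn : (-1) ^+ m * ((-1) ^+ m) ^+ (m - 2) = 1 :> K.
  rewrite -exprS -exprM -signr_odd oddM oddS oddB //=.
  by rewrite addbF andbN expr0.
by rewrite exprMn mulrACA sgn mul1r -exprM exprS mulrA [geo _ _ * _]mulrC.
Qed.

Lemma int_poly_divp (p : nat) (q : {poly int}) : prime p ->
  map_poly (intr : int -> 'F_p) q = 0 ->
  exists q' : {poly int}, q = p%:Z *: q'.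
Proof.
move=> p_pr q0; exists (map_poly (fun a => (a %/ p%:Z)%Z) q).
apply/polyP => i; rewrite coefZ coef_map_id0 ?div0z //.
have := congr1 (fun r : {poly 'F_p} => r`_i) q0; rewrite coef_map coef0 /=.
move/eqP; rewrite -(dvdz_pcharf (pchar_Fp p_pr)) => h.
by rewrite mulrC divzK.
Qed.

(* As [eulres j] is nonzero modulo [p], a factor [p] of [a] divides [q], so [a]
   may be taken prime to [p] and the equation read modulo [p]. *)
Lemma not_int_dvd_deriv2 j p e (a : int) (q : {poly int}) :
  prime p -> ~~ (p %| j)%N -> (1 < j)%N -> m = (p ^ e)%N -> (1 < m)%N ->
  a != 0 -> a *: ('X * (eulres j)^`() ^+ 2) = eulres j * q -> False.
Proof.
move=> p_pr pj j1 mE m1.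
have QE := eulres_pchar j p_pr mE m1.
have [c] := ubnP `|a|%N; elim: c a q => // c IHc a q ac a0 aq.
pose r : {rmorphism int -> 'F_p} := intr.
have := congr1 (map_poly r) aq.
rewrite expr2 map_polyZ !rmorphM /= map_polyX -deriv_map QE.
set Q := geo j 'X * _ => eq_r.
have Qnz : Q != 0.
  by rewrite mulf_neq0 ?expf_neq0 ?polyX_eq0 ?geo_neq0 // ltnW.
have [ra0|ra0] := eqVneq (r a) 0.
  move/eqP: eq_r; rewrite ra0 scale0r eq_sym mulf_eq0 (negbTE Qnz) /= => /eqP q0.
  have [q' qE] := int_poly_divp p_pr q0.
  move/eqP: ra0; rewrite -(dvdz_pcharf (pchar_Fp p_pr)) => /dvdzP[a' aE].
  have p0 : p%:Z != 0 by rewrite eqz_nat -lt0n prime_gt0.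
  apply: (IHc a' q').
  - apply: (@leq_trans `|a|%N); last by [].
    rewrite aE abszM absz_nat.
    apply: ltn_Pmulr; first exact: prime_gt1.
    by rewrite absz_gt0; apply: contraNneq a0 => a'0; rewrite aE a'0 mul0r.
  - by apply: contraNneq a0 => a'0; rewrite aE a'0 mul0r.
  have pP0 : p%:Z%:P != 0 :> {poly int} by rewrite polyC_eq0.
  apply: (mulfI pP0); rewrite !mul_polyC scalerA [_ * a']mulrC -aE aq qE.
  by rewrite scalerAr.
(* Compare both sides at a zero [z] of J modulo p: the right side vanishes, while the left one does
   not, as [z] is a simple nonzero zero of [Q]. *)
have [|K [h [z gz]]] := exists_root_ext (p := geo j 'X : {poly 'F_p}).
  by rewrite size_geo.
have geoh : map_poly h (geo j 'X) = geo j 'X 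
  by rewrite (geo_morph (map_poly h)) /= map_polyX.
rewrite /root geoh horner_geo in gz.
have jK : j%:R != 0 :> K.
  by rewrite -(rmorph_nat h) fmorph_eq0 -(dvdn_pcharf (pchar_Fp p_pr)).
have [z0 g'z] := geo_root_simple jK (eqP gz).
have Qz : (map_poly h Q).[z] = 0.
  by rewrite /Q rmorphM /= hornerM geoh horner_geo (eqP gz) mul0r.
move/(congr1 (fun u => (map_poly h u).[z])): eq_r.
rewrite rmorphM /= hornerM Qz mul0r -mul_polyC !rmorphM /= !hornerM map_polyC map_polyX.
rewrite hornerC hornerX -deriv_map; apply/eqP.
rewrite !mulf_neq0 ?fmorph_eq0 // /Q rmorphM /= geoh rmorphXn /= map_polyX;
rewrite derivM hornerD !hornerM horner_geo (eqP gz) mul0r addr0 hornerXn;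
by rewrite mulf_neq0 ?expf_neq0.
Qed.

(** A polynomial [s] is produced rather than a root, so that the root can be taken in an extension
    of k. *)
Lemma exists_simple_root_eulres j p e :
  prime p -> ~~ (p %| j)%N -> (1 < j)%N -> m = (p ^ e)%N -> (1 < m)%N ->
  exists s : {poly rat}, (1 < size s)%N /\
    forall (K : fieldType) (h : {rmorphism rat -> K}) (y : K),
      root (map_poly h s) y ->
      let q := map_poly intr (eulres j) in
      [/\ y != 0, q.[y] = 0 & q^`().[y] != 0].
Proof.
move=> p_pr pj j1 mE m1; pose Q : {poly rat} := map_poly intr (eulres j).
have inj : injective (map_poly (intr : int -> rat)).
  by apply: map_inj_poly => //; exact: intr_inj.
have Qnz : Q != 0.
  have enz : eulres j != 0.
    apply/eqP => e0; have /eqP := eulres_pchar j p_pr mE m1.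
    rewrite e0 rmorph0 eq_sym; apply/negP.
    by rewrite mulf_neq0 ?expf_neq0 ?polyX_eq0 ?geo_neq0 // ltnW.
  by rewrite -(rmorph0 (map_poly intr)) (inj_eq inj).
(* [P] is the squarefree part of [Q]; removing its common factor with x G leaves exactly the roots
   of [Q] that are nonzero and simple. *)
pose G := gcdp Q Q^`(); pose P := Q %/ G; pose d := gcdp P ('X * G).
have GQ : G %| Q by exact: dvdp_gcdl.
have GQ' : G %| Q^`() by exact: dvdp_gcdr.
have PG : P * G = Q by exact: divpK.
have dP : d %| P by exact: dvdp_gcdl.
have Pnz : P != 0 by apply: contraNneq Qnz => P0; rewrite -PG P0 mul0r.
have sepP : separable_poly P by exact: make_separable.
have sd : P %/ d * d = P by exact: divpK.
exists (P %/ d); split=> [|K h y].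
  (* If only a constant were left, P would divide x G, so Q = P G would divide x Q'^2, which
     [not_int_dvd_deriv2] excludes once denominators are cleared. *)
  rewrite ltnNge; apply/negP => s1.
  have Pd : P %| d.
    rewrite -[X in X %| _]sd; move: sd; rewrite (size1_polyC s1) mul_polyC => sd'.
    rewrite dvdpZl //; apply: contraNneq Pnz => c0.
    by rewrite -sd' c0 scale0r.
  have : Q %| 'X * Q^`() ^+ 2.
    rewrite -{1}PG expr2 mulrA; apply: dvdp_mul => //; apply: dvdp_trans Pd _.
    by apply: dvdp_trans (dvdp_gcdr _ _) _; apply: dvdp_mul.
  case/dvdpP=> W WE; have [w [a a0 wE]] := rat_poly_scale W.
  apply: (@not_int_dvd_deriv2 j p e a w) => //; apply: (inj).
  rewrite map_polyZ expr2 !rmorphM /= map_polyX -deriv_map -/Q.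
  rewrite expr2 in WE; rewrite WE wE -scalerAl scalerA divff ?intr_eq0 //.
  by rewrite scale1r mulrC.
move=> ry q.
have qE : q = map_poly h Q.
  rewrite /Q -map_poly_comp; apply: eq_map_poly => z; by rewrite /= rmorph_int.
have cop : coprimep (P %/ d) ('X * G).
  have /and3P[_ _ /coprimepP cd] : [&& separable_poly (P %/ d),
      separable_poly d & coprimep (P %/ d) d] by rewrite -separable_mul sd.
  apply/coprimepP => u us uXG; apply: cd => //; rewrite dvdp_gcd uXG andbT.
  by rewrite -sd dvdp_mulr.
have ryP : root (map_poly h P) y by rewrite -sd rmorphM rootM ry.
have : ~~ root (map_poly h ('X * G)) y.
  by apply: coprimep_root ry; rewrite coprimep_map.
rewrite rmorphM /= rootM map_polyX negb_or rootX => /andP[y0 Gy].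
split=> //; first by rewrite qE -PG rmorphM hornerM (rootP ryP) mul0r.
apply: contra Gy => qy; rewrite gcdp_map root_gcd -deriv_map -qE {2}/root qy andbT.
by rewrite qE -PG rmorphM rootM ryP.
Qed.

End EulerResultant.

(** [disc] comes from an opaque existence result, so base change is checked after applying [f],
    where both sides equal [vdm v ^+ 2]. *)
Lemma disc_map m (A B : comNzRingType) (g : {rmorphism A -> B}) (T : {poly A})
  (R : idomainType) (f : {rmorphism B -> R}) (v : 'I_m -> R) :
  injective f -> map_poly f (map_poly g T) = \prod_(i < m) ('X - (v i)%:P) ->
  g (disc m T) = disc m (map_poly g T).
Proof.
move=> f_inj fT; apply: (f_inj); rewrite (discE fT).
have gT : map_poly (f \o g) T = \prod_(i < m) ('X - (v i)%:P).
  by rewrite map_poly_comp.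
by rewrite -(discE gT).
Qed.

(** * A transposition and transitivity for T over k[y] *)

Section TutteTransposition.
Variables (k : fieldType) (iota : {rmorphism rat -> k}) (m j p e : nat).
Hypotheses (p_pr : prime p) (pj : ~~ (p %| j)%N) (j1 : (1 < j)%N).
Hypotheses (mE : m = (p ^ e)%N) (m1 : (1 < m)%N).
Local Notation D := (disc m (tut m j ('X : {poly k}))).

Lemma pchar_rat_ext (K : fieldType) (h : {rmorphism rat -> K}) :
  [pchar K] =i pred0.
Proof. by move=> q; rewrite (fmorph_pchar h) Num.Theory.pchar_num. Qed.

Lemma disc_tut_int :
  map_poly (intr : int -> k) (disc m (tut m j ('X : {poly int}))) = D.
Proof.
pose io : {rmorphism {poly k} -> {fraction {poly k}}} :=
  @FracField.tofrac {poly k}.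
have [K [h [v vE]]] := exists_tut_roots j (io 'X) (ltnW m1).
pose g : {rmorphism {poly int} -> {poly k}} := map_poly (intr : int -> k).
have f_inj : injective (h \o io).
  by move=> a b /fmorph_inj /eqP; rewrite tofrac_eq => /eqP.
have gT : map_poly g (tut m j 'X) = tut m j 'X.
  by rewrite tut_morph /= map_polyX.
rewrite -[LHS]/(g _) (disc_map (f := h \o io) (v := v)) ?gT //.
by rewrite tut_morph.
Qed.

(** A nonzero simple root of Q is not a root of J, so by y D = +- J^(m-1) Q it is a simple root of
    D. *)
Lemma exists_simple_root_disc :
  exists (K : fieldType) (h : {rmorphism k -> K}) (y : K) (w : 'I_m -> K),
  [/\ tut m j y = \prod_(i < m) ('X - (w i)%:P),
      (map_poly h D).[y] = 0 & (map_poly h D)^`().[y] != 0].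
Proof.
have [s [s1 hs]] := exists_simple_root_eulres p_pr pj j1 mE m1.
have [|K1 [h1 [y1 sy1]]] := @exists_root_ext k (map_poly iota s).
  by rewrite size_map_poly.
have [K2 [h2 [w wE]]] := exists_tut_roots j y1 (ltnW m1).
pose h : {rmorphism k -> K2} := h2 \o h1; pose y := h2 y1.
exists K2, h, y, w.
have sy : root (map_poly (h \o iota) s) y.
  by rewrite map_poly_comp map_poly_comp; apply: rmorph_root.
have [] := hs K2 (h \o iota) y sy; set q := map_poly _ _ => y0 qy q'y.
have [b /(congr1 (map_poly (intr : int -> K2)))] :=
  disc_eulres (ltnW m1) (ltnW j1).
pose io : {rmorphism int -> K2} := intr.
have -> : map_poly h D = map_poly io (disc m (tut m j 'X)).
  rewrite -disc_tut_int -map_poly_comp; apply: eq_map_poly => z.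
  by rewrite /= !rmorph_int.
rewrite -!/io !rmorphM !rmorphXn rmorphN1 (geo_morph (map_poly io)) /= map_polyX.
rewrite -/q; set D' := map_poly io _ => E.
have gy : geo j y != 0.
  apply/eqP => gy; pose f : {rmorphism {poly int} -> K2} :=
    horner_eval y \o map_poly io.
  have fX : f 'X = y by rewrite /f /= map_polyX horner_evalE hornerX.
  have := @eulres_geo_root m j K2 f (ltnW m1); rewrite fX gy => /(_ erefl).
  rewrite /f /= horner_evalE -/q qy => /esym/eqP.
  rewrite expf_eq0 mulf_eq0 (negbTE y0) orbF.
  have /pcharf0P -> := pchar_rat_ext (h \o iota).
  by rewrite eqn0Ngt (ltnW m1).
have D'y : D'.[y] = 0.
  move/(congr1 (fun u => u.[y])): E; rewrite hornerM hornerX [in RHS]hornerM qy mulr0.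
  by move/eqP; rewrite mulf_eq0 (negbTE y0) => /eqP.
split=> //; apply: contra q'y => /eqP D'y'; move/(congr1 (fun u => u^`().[y])): E.
rewrite derivM [in RHS]derivM derivX mul1r !hornerD D'y add0r hornerM D'y' mulr0.
set c := _ * _ ^+ _; rewrite [in RHS]hornerM qy mulr0 add0r hornerM => /esym/eqP.
rewrite mulf_eq0 => /orP[|//]; rewrite /c hornerM mulf_eq0.
have -> : (-1) ^+ b = ((-1) ^+ b)%:P :> {poly K2} by rewrite rmorphXn rmorphN1.
by rewrite hornerC signr_eq0 horner_exp horner_geo expf_eq0 (negbTE gy) andbF.
Qed.

Lemma exists_tperm (R : idomainType) (f : {rmorphism {poly k} -> R})
  (v : 'I_m -> R) (H : {group 'S_m}) :
  injective f -> tut m j (f 'X) = \prod_(i < m) ('X - (v i)%:P) ->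
  (forall P : {mpoly {poly k}[m]},
     (forall s, s \in H -> mmap f v (msym s P) = mmap f v P) ->
     exists a, mmap f v P = f a) ->
  exists a b, a != b /\ tperm a b \in H.
Proof.
move=> f_inj fT inv.
have [K [h [y [w [wE Dy D'y]]]]] := exists_simple_root_disc.
pose g : {rmorphism {poly k} -> K} := horner_eval y \o map_poly h.
have gT : map_poly g (tut m j 'X) = \prod_(i < m) ('X - (w i)%:P).
  by rewrite tut_morph -wE /= map_polyX horner_evalE hornerX.
apply: (@exists_tperm_of_simple_root m _ (tut m j 'X) R K f g v w) => //.
- exact: (pchar_rat_ext (h \o iota)).
- by rewrite tut_morph.
- exact: disc_simple_root gT D'y.
(* If a^2 = D b and D has a simple zero at y, then a(y) = 0, and differentiating gives 0 = D'(y)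
   b(y). *)
move=> a b /(congr1 (map_poly h)); rewrite expr2 !rmorphM /= => E.
have ay : root (map_poly h a) y.
  move/(congr1 (fun u => u.[y])): E; rewrite [in RHS]hornerM Dy mul0r.
  by move/eqP; rewrite hornerM mulf_eq0 orbb.
move/(congr1 (fun u => u^`().[y])): E; rewrite deriv_mul_root2 //.
rewrite derivM hornerD !hornerM Dy mul0r addr0 => /esym/eqP.
by rewrite mulf_eq0 (negbTE D'y) => /eqP.
Qed.

(* Eisenstein's argument at a root [z] of [geo j]: all roots of [tut m j z]
   vanish, while [y * geo j y] has a simple zero at [z]. *)
Lemma tut_transitive (R : idomainType) (f : {rmorphism {poly k} -> R})
  (v : 'I_m -> R) (H : {group 'S_m}) (O : {set 'I_m}) :
  injective f -> tut m j (f 'X) = \prod_(i < m) ('X - (v i)%:P) ->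
  (forall P : {mpoly {poly k}[m]},
     (forall s, s \in H -> mmap f v (msym s P) = mmap f v P) ->
     exists a, mmap f v P = f a) ->
  (forall s i, s \in H -> (s i \in O) = (i \in O)) ->
  O = set0 \/ O = setT.
Proof.
move=> f_inj fT inv HO.
have k0 : j%:R != 0 :> k.
  have /pcharf0P -> := pchar_rat_ext iota.
  by rewrite -lt0n ltnW.
have [|K [h [z]]] := exists_root_ext (p := geo j 'X : {poly k}).
  by rewrite size_geo.
rewrite /root (geo_morph (map_poly h)) /= map_polyX horner_geo => /eqP gz.
have jK : j%:R != 0 :> K by rewrite -(rmorph_nat h) fmorph_eq0.
have [z0 g'z] := geo_root_simple jK gz.
pose g : {rmorphism {poly k} -> K} := horner_eval z \o map_poly h.
have gX : g 'X = z by rewrite /g /= map_polyX horner_evalE hornerX.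
have gT : map_poly g (tut m j 'X) = \prod_(i < m) ('X - 0%:P).
  rewrite tut_morph gX /tut gz polyC0 mulr0 addr0 subr0.
  by rewrite prodr_const card_ord.
(* The product of the roots over a nonempty [H]-stable set comes from some [a] in k[y] that vanishes
   at [z], as every root does there. Applied to [O] and its complement, this gives y J a double
   zero. *)
have main (U : {set 'I_m}) : U != set0 ->
    (forall s i, s \in H -> (s i \in U) = (i \in U)) ->
    exists2 a, g a = 0 & f a = \prod_(i in U) v i.
  move=> /set0Pn[u uU] HU; pose P : {mpoly {poly k}[m]} := \prod_(i in U) 'X_i.
  have PE (S : idomainType) (g' : {rmorphism {poly k} -> S}) v' :
      mmap g' v' P = \prod_(i in U) v' i.
    by rewrite rmorph_prod; apply: eq_bigr => i _; rewrite /= mmapXU.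
  have [|a Pa] := inv P.
    move=> s sH; rewrite mmap_msym !PE [RHS](reindex_inj (@perm_inj _ s)).
    by apply: eq_bigl => i; rewrite HU.
  have fT' : map_poly f (tut m j 'X) = \prod_(i < m) ('X - (v i)%:P).
    by rewrite tut_morph.
  have [s ga] := mpoly_specialize f_inj fT' gT Pa.
  exists a; last by rewrite -Pa PE.
  by rewrite ga PE (bigD1 u) //= mul0r.
have [->|O0] := eqVneq O set0; first by left.
have [->|OT] := eqVneq O setT; first by right.
have [||a ga fa] := main O => //.
have [|s i sH|a' ga' fa'] := main (~: O).
- by apply: contraNneq OT => h0; rewrite -(setCK O) h0 setC0.
- by rewrite !inE HO.
have ra : root (map_poly h a) z by exact/rootP.
have ra' : root (map_poly h a') z by exact/rootP.
have aa : a * a' = (-1) ^+ m * ('X * geo j 'X).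
  apply: (f_inj); rewrite !rmorphM rmorphXn rmorphN1 geo_morph.
  rewrite -(prod_tut_roots0 fT (ltnW m1)) fa fa' [RHS](bigID (mem O)) /=.
  by congr (_ * _); apply: eq_bigl => i; rewrite !inE.
move/(congr1 (fun u => (map_poly h u)^`().[z])): aa.
rewrite rmorphM /= deriv_mul_root2 //.
rewrite !rmorphM rmorphXn rmorphN1 (geo_morph (map_poly h)) /= map_polyX.
have -> : (-1) ^+ m = ((-1) ^+ m)%:P :> {poly K} by rewrite rmorphXn rmorphN1.
rewrite mul_polyC derivZ hornerZ derivM derivX mul1r hornerD horner_geo gz add0r.
rewrite hornerM hornerX => /esym/eqP.
by rewrite !mulf_eq0 signr_eq0 (negbTE z0) (negbTE g'z).
Qed.

End TutteTransposition.

(** * The place at infinity *)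

Lemma poly_eq_nonzero (K : fieldType) (p q : {poly K}) :
  [pchar K] =i pred0 -> (forall x, x != 0 -> p.[x] = q.[x]) -> p = q.
Proof.
move=> K0 pq; apply/eqP; rewrite -subr_eq0; apply/negPn/negP => pq0.
have [|c] := exists_nat_nonroot (q := 'X * (p - q)) K0.
  by rewrite mulf_neq0 ?polyX_eq0.
rewrite hornerM hornerX mulf_eq0 negb_or => /andP[/pq c0].
by rewrite hornerD hornerN c0 subrr eqxx.
Qed.

(* With [y = s ^- m.-1] and [x = geo j (s ^+ m.-1) / (s * w)], the equation
   [tut m j y = 0] in [x] becomes [infty_poly = 0] in [w], which at [s = 0]
   reads [w ^+ m + w = 0]. *)
Definition infty_poly (R : comNzRingType) m j (s : R) : {poly R} :=
  let t := geo j (s ^+ m.-1) in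
  'X^m + (\sum_(1 <= i < m) (s ^+ i.-1 * t ^+ (m - i))%:P * 'X^i
          + (s ^+ (m.-1 * j - m) * t ^+ m.-1)%:P).

Lemma infty_poly_morph (R S : comNzRingType) (f : {rmorphism R -> S}) m j s :
  map_poly f (infty_poly m j s) = infty_poly m j (f s).
Proof.
rewrite /infty_poly !rmorphD rmorph_sum /= map_polyXn map_polyC /=.
rewrite rmorphM !rmorphXn geo_morph rmorphXn; congr (_ + (_ + _)).
apply: eq_bigr => i _; rewrite rmorphM /= map_polyC map_polyXn /=.
by rewrite rmorphM !rmorphXn geo_morph rmorphXn.
Qed.

Lemma infty_poly_monic_size (R : comNzRingType) m j (s : R) : (0 < m)%N ->
  infty_poly m j s \is monic /\ size (infty_poly m j s) = m.+1.
Proof.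
move=> m0; rewrite /infty_poly; set p := (X in 'X^m + X).
have sp : (size p < size ('X^m : {poly R}))%N.
  rewrite size_polyXn ltnS (leq_trans (size_polyD _ _)) // geq_max.
  rewrite (leq_trans (size_polyC_leq1 _)) // andbT big_nat.
  elim/big_ind: _ => [|a b sa sb|i /andP[_ im]]; first by rewrite size_poly0.
    by rewrite (leq_trans (size_polyD _ _)) // geq_max sa.
  by rewrite mul_polyC (leq_trans (size_scale_leq _ _)) // size_polyXn.
split; last by rewrite size_polyDl // size_polyXn.
by rewrite monicE lead_coefDl // lead_coefXn.
Qed.

Lemma horner_infty (R : comNzRingType) m j (s w : R) :
  (infty_poly m j s).[w] = w ^+ m
    + (\sum_(1 <= i < m) s ^+ i.-1 * geo j (s ^+ m.-1) ^+ (m - i) * w ^+ i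
       + s ^+ (m.-1 * j - m) * geo j (s ^+ m.-1) ^+ m.-1).
Proof.
rewrite /infty_poly !hornerD hornerXn hornerC horner_sum; congr (_ + (_ + _)).
by apply: eq_bigr => i _; rewrite hornerM hornerC hornerXn.
Qed.

Lemma geo_expr0 (R : comNzRingType) j e : (0 < j)%N -> (0 < e)%N ->
  geo j ((0 : R) ^+ e) = 1.
Proof.
move=> j0 e0; rewrite expr0n gtn_eqF // /geo big_ltn // expr0 big_nat big1 ?addr0 //.
by move=> i /andP[i1 _]; rewrite expr0n gtn_eqF.
Qed.

Lemma infty_poly0 (R : comNzRingType) m j : (2 < m)%N -> (1 < j)%N ->
  infty_poly m j (0 : R) = 'X^m + 'X.
Proof.
move=> m2 j1; have z : geo j ((0 : R) ^+ m.-1) = 1 by apply: geo_expr0; lia.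
rewrite /infty_poly z; congr (_ + _).
have -> : (0 : R) ^+ (m.-1 * j - m) = 0 by rewrite expr0n gtn_eqF //; nia.
rewrite mul0r polyC0 addr0 big_ltn 1?ltnW // big_nat big1 ?addr0.
  by rewrite expr0 expr1n mul1r polyC1 mul1r.
move=> i /andP[i1 _]; rewrite expr0n gtn_eqF ?mul0r ?polyC0 ?mul0r //.
by case: i i1 => [|[|i]].
Qed.

Lemma geo_inv (F : fieldType) j (t : F) : (0 < j)%N -> t != 0 ->
  t ^+ j.-1 * geo j t^-1 = geo j t.
Proof.
move=> j0 t0; rewrite /geo mulr_sumr [RHS]big_nat_rev /= add0n !big_nat.
apply: eq_bigr => i /andP[_ ij]; rewrite exprVn.
apply: (mulIf (expf_neq0 i t0)); rewrite mulfVK ?expf_neq0 // -exprD.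
by congr (_ ^+ _); lia.
Qed.

Lemma infty_eq (K : fieldType) m j (s x : K) : (2 < m)%N -> (1 < j)%N ->
  s != 0 -> x != 0 -> geo j (s ^+ m.-1) != 0 ->
  x ^+ m * (infty_poly m j s).[geo j (s ^+ m.-1) / s / x]
  = s ^+ (m.-1 * j - m) * geo j (s ^+ m.-1) ^+ m.-1
    * (tut m j (s ^- m.-1)).[x].
Proof.
move=> m2 j1 s0 x0; set t := s ^+ m.-1; set J := geo j t => J0.
have t0 : t != 0 by rewrite expf_neq0.
have JE : geo j t^-1 = J / t ^+ j.-1.
  by rewrite -[J](geo_inv (ltnW j1) t0) mulrAC divff ?mul1r ?expf_neq0.
rewrite horner_infty -/t -/J horner_tut JE.
set E := (m.-1 * j - m)%N.
(* The truncated subtraction in [E] is exact because m <= (m - 1) j, whence E + 1 = (m - 1) (j -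
   1). *)
have sE : s ^+ E * s = t ^+ j.-1.
  by rewrite -exprSr /t -exprM; congr (_ ^+ _); rewrite /E; nia.
have tj0 : t ^+ j.-1 != 0 by rewrite expf_neq0.
have sm : s ^+ m = t * s by rewrite /t -exprSr prednK //; lia.
have JmE : J ^+ m = J ^+ m.-1 * J by rewrite -exprSr prednK //; lia.
have -> : \sum_(1 <= i < m) s ^+ i.-1 * J ^+ (m - i) * (J / s / x) ^+ i
    = J ^+ m / s / x ^+ m * \sum_(1 <= i < m) x ^+ i.
  rewrite mulr_sumr [RHS]big_nat_rev /= !big_nat; apply: eq_bigr => i /andP[i1 im].
  rewrite add1n subSS.
  have -> : x ^+ m = x ^+ (m - i) * x ^+ i by rewrite -exprD subnK // ltnW.
  have -> : J ^+ m = J ^+ (m - i) * J ^+ i by rewrite -exprD subnK // ltnW.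
  have si : s ^+ i = s ^+ i.-1 * s by rewrite -exprSr prednK.
  rewrite !exprMn !exprVn si.
  by field; rewrite s0 !expf_neq0.
rewrite !exprMn !exprVn sm -sE JmE; move: (\sum_(_ <= _ < _) _) => S.
by field; rewrite s0 t0 !expf_neq0.
Qed.

Section Infinity.
Variables (K : fieldType) (m j : nat) (s : K) (W : 'I_m -> K).
Local Notation J := (geo j (s ^+ m.-1)).
Hypotheses (K0 : [pchar K] =i pred0) (m2 : (2 < m)%N) (j1 : (1 < j)%N).
Hypotheses (s0 : s != 0) (J0 : J != 0).
Hypothesis WE : infty_poly m j s = \prod_(i < m) ('X - (W i)%:P).

Lemma prod_infty_roots :
  \prod_(i < m) W i = (-1) ^+ m * (s ^+ (m.-1 * j - m) * J ^+ m.-1).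
Proof.
have := congr1 (fun q => (-1) ^+ m * q.[0]) WE.
rewrite horner_infty expr0n gtn_eqF ?(ltnW (ltnW m2)) // add0r big_nat.
rewrite big1 => [|i /andP[i1 _]].
  rewrite add0r => ->; rewrite horner_prod.
  have -> : (-1) ^+ m = \prod_(i < m) (-1 : K) by rewrite prodr_const card_ord.
  by rewrite -big_split; apply: eq_bigr => i _; rewrite /= !hornerE mulN1r opprK.
by rewrite expr0n gtn_eqF // mulr0.
Qed.

Lemma infty_root_neq0 i : W i != 0.
Proof.
have : \prod_(i < m) W i != 0.
  by rewrite prod_infty_roots !mulf_neq0 ?signr_eq0 ?expf_neq0.
by rewrite (bigD1 i) //= mulf_eq0 negb_or => /andP[].
Qed.

(** The substitution requires x to be nonzero; in characteristic 0 comparing values at such x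
    suffices. *)
Lemma tut_infty_factor :
  tut m j (s ^- m.-1) = \prod_(i < m) ('X - (J / s / W i)%:P).
Proof.
apply: (poly_eq_nonzero K0) => x x0; rewrite horner_prod.
set C := s ^+ (m.-1 * j - m) * J ^+ m.-1.
have C0 : C != 0 by rewrite mulf_neq0 ?expf_neq0.
apply: (mulfI C0); rewrite -(infty_eq m2 j1 s0 x0 J0) WE horner_prod.
have -> : x ^+ m = \prod_(i < m) x by rewrite prodr_const card_ord.
have -> : C = \prod_(i < m) - W i.
  by rewrite prodrN card_ord prod_infty_roots mulrA -exprD addnn -signr_odd odd_double mul1r.
rewrite -!big_split; apply: eq_bigr => i _ /=; rewrite !hornerE.
by field; rewrite x0 s0 infty_root_neq0.
Qed.

End Infinity.

(* At [y = infinity] the Newton polygon of [tut m j y] has one root of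
   valuation [1 - j] and [m - 1] conjugate ones of valuation [- 1 / (m - 1)],
   which the blocks of [e] cannot respect. *)
Lemma tut_no_block (k : fieldType) m j (R : idomainType)
  (f : {rmorphism {poly k} -> R}) (v : 'I_m -> R) (e : rel 'I_m) d a :
  [pchar k] =i pred0 -> (2 < m)%N -> (1 < j)%N ->
  injective f -> tut m j (f 'X) = \prod_(i < m) ('X - (v i)%:P) ->
  equivalence_rel e -> (forall i, #|[pred l | e i l]| = d) ->
  \sum_(i < m) \prod_(l < m | e i l) v l = f a ->
  (d = 1 \/ d = m)%N.
Proof.
move=> k0 m2 j1 f_inj fT eqe cardd va.
have m0 : (0 < m)%N by lia.
have e_refl i : e i i by have [] := eqe i i i.
have e_sym i l : e i l = e l i.
  have sym x z : e x z -> e z x.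
    by move=> xz; have [_ h] := eqe x z x; rewrite -(h xz) e_refl.
  by apply/idP/idP; apply: sym.
have d0 : (0 < d)%N.
  by rewrite -(cardd (Ordinal m0)); apply/card_gt0P; exists (Ordinal m0); exact: e_refl.
have [->|dm] := eqVneq d m; [by right | left].
have ltdm : (d < m)%N.
  rewrite ltn_neqAle dm -(cardd (Ordinal m0)) -[X in (_ <= X)%N]card_ord; exact: max_card.
pose io : {rmorphism {poly k} -> {fraction {poly k}}} :=
  @FracField.tofrac {poly k}.
pose Jt : {poly k} := geo j ('X ^+ m.-1).
have [mon_W sW] := infty_poly_monic_size j (io 'X) m0.
have [K [h [W0 WE]]] := exists_splitting mon_W sW.
pose fK : {rmorphism {poly k} -> K} := h \o io.
have fK_inj : injective fK.
  by move=> x z /fmorph_inj /eqP; rewrite tofrac_eq => /eqP.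
pose s := fK 'X; rewrite infty_poly_morph -[h _]/s in WE.
have KE : [pchar K] =i pred0.
  by move=> q; rewrite (fmorph_pchar (fK \o polyC)) k0.
have s0 : s != 0 by rewrite -(rmorph0 fK) (inj_eq fK_inj) polyX_eq0.
have JE : geo j (s ^+ m.-1) = fK Jt by rewrite -rmorphXn -geo_morph.
have Jt0 : Jt.[0] = 1.
  rewrite -horner_evalE /Jt geo_morph rmorphXn /= horner_evalE hornerX.
  by apply: geo_expr0; lia.
have J0 : geo j (s ^+ m.-1) != 0.
  rewrite JE -(rmorph0 fK) (inj_eq fK_inj).
  by apply: contra_eq_neq Jt0 => ->; rewrite horner0 eq_sym oner_neq0.
have Wnz := infty_root_neq0 m2 s0 J0 WE.
(* [g1] sends y to s^-(m-1), whereas [fK] reads the variable as [s] itself, so that polynomials in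
   [s] can later be specialized at 0. *)
pose g1 : {rmorphism {poly k} -> K} :=
  horner_eval (s ^- m.-1) \o map_poly (fK \o polyC).
have g1T : map_poly g1 (tut m j 'X)
    = \prod_(i < m) ('X - (geo j (s ^+ m.-1) / s / W0 i)%:P).
  rewrite tut_morph -(tut_infty_factor KE m2 j1 s0 J0 WE).
  by rewrite /g1 /= map_polyX horner_evalE hornerX.
have fT' : map_poly f (tut m j 'X) = \prod_(i < m) ('X - (v i)%:P).
  by rewrite tut_morph.
pose P : {mpoly {poly k}[m]} := \sum_(i < m) \prod_(l < m | e i l) 'X_l.
have PE (S : idomainType) (g : {rmorphism {poly k} -> S}) u :
    mmap g u P = \sum_(i < m) \prod_(l < m | e i l) u l.
  rewrite raddf_sum; apply: eq_bigr => i _; rewrite /= rmorph_prod.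
  by apply: eq_bigr => l _; rewrite /= mmapXU.
(* Under [g1] the roots are c / W_l; multiplied by the product of all W_l, a block product becomes
   c^d times the product of the W_l outside the block. *)
pose P' : {mpoly {poly k}[m]} := \sum_(i < m) \prod_(l < m | ~~ e i l) 'X_l.
have P'E (S : idomainType) (g : {rmorphism {poly k} -> S}) u :
    mmap g u P' = \sum_(i < m) \prod_(l < m | ~~ e i l) u l.
  rewrite raddf_sum; apply: eq_bigr => i _; rewrite /= rmorph_prod.
  by apply: eq_bigr => l _; rewrite /= mmapXU.
have [|r g1a] := mpoly_specialize (P := P) (a := a) f_inj fT' g1T.
  by rewrite PE.
rewrite PE in g1a; pose W i := W0 (r i).
have WE' : map_poly fK (infty_poly m j 'X) = \prod_(i < m) ('X - (W i)%:P).
  by rewrite infty_poly_morph WE (reindex_inj (@perm_inj _ r)).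
(* For nonzero [a] this is its degree. Then [a'] stands for s^((m-1) N) a(s^-(m-1)), with the
   leading coefficient of [a] as constant term. *)
pose N := (size a).-1.
pose a' : {poly k} := \sum_(i < N.+1) a`_i *: 'X ^+ (m.-1 * (N - i)).
have a'E : g1 a * s ^+ (m.-1 * N) = fK a'.
  rewrite /g1 /= horner_evalE (@horner_coef_wide _ N.+1); last first.
    by rewrite size_map_poly /N; case: size.
  rewrite mulr_suml -[RHS]/(fK a') /a' rmorph_sum; apply: eq_bigr => i _.
  rewrite coef_map -mul_polyC rmorphM rmorphXn -[fK 'X]/s -mulrA; congr (_ * _).
  rewrite exprVn -exprM; apply: (mulfI (expf_neq0 (m.-1 * i) s0)).
  rewrite mulVKf ?expf_neq0 // -exprD -mulnDr subnKC //.
  by rewrite -ltnS.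
(* [E2] adds the exponent of s in the product of the W_l to the [d] coming from c^d = (J / s)^d;
   [b0] collects the remaining factors. *)
pose E2 := (m.-1 * j - m + d)%N.
pose b0 : {poly k} := (-1) ^+ m * (a' * Jt ^+ (m.-1 - d)).
have main : mmap fK W P' * s ^+ (m.-1 * N) = fK (b0 * 'X ^+ E2).
  set c := geo j (s ^+ m.-1) / s in g1a.
  have c0 : c != 0 by rewrite mulf_neq0 ?invr_eq0.
  have prodW : \prod_(l < m) W l
      = (-1) ^+ m * (s ^+ (m.-1 * j - m) * geo j (s ^+ m.-1) ^+ m.-1).
    by rewrite -(prod_infty_roots m2 WE) [RHS](reindex_inj (@perm_inj _ r)).
  have {}g1a : g1 a * \prod_(l < m) W l = c ^+ d * mmap fK W P'.
    rewrite g1a P'E mulr_suml mulr_sumr; apply: eq_bigr => i _.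
    rewrite [X in _ * X](bigID (e i)) /= mulrA -big_split /=; congr (_ * _).
    rewrite (eq_bigr (fun=> c)) => [|l _]; last by rewrite mulfVK ?Wnz.
    by rewrite prodr_const cardd.
  apply: (mulfI (expf_neq0 d c0)); rewrite mulrA -g1a mulrAC a'E prodW.
  rewrite /b0 !rmorphM !rmorphXn rmorphN1 -JE -[fK 'X]/s /E2 exprD /c exprMn exprVn.
  have -> : (m.-1 = m.-1 - d + d)%N by lia.
  rewrite addnK exprD; field; rewrite ?expf_neq0 //.
have [k2 [h2 [w wE]]] : exists (k2 : fieldType) (h2 : {rmorphism k -> k2})
    (w : 'I_m -> k2), 'X^m + 'X = \prod_(i < m) ('X - (w i)%:P).
  have [mon_0 s_0] := infty_poly_monic_size j (0 : k) m0.
  have [k2 [h2 [w wE]]] := exists_splitting mon_0 s_0.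
  by exists k2, h2, w; rewrite -wE infty_poly_morph rmorph0 infty_poly0.
pose g2 : {rmorphism {poly k} -> k2} := h2 \o horner_eval 0.
have g2X : g2 'X = 0 by rewrite /g2 /= horner_evalE hornerX rmorph0.
have g2T : map_poly g2 (infty_poly m j 'X) = \prod_(i < m) ('X - (w i)%:P).
  by rewrite infty_poly_morph g2X infty_poly0.
(* Exactly one root of w^m + w is zero, and it is simple. Only the [d] indices in its block
   contribute to the sum, each with the same nonzero product. *)
have P'nz (t : 'S_m) : mmap g2 (fun i => w (t i)) P' != 0.
  rewrite P'E; have [i0 wi0] : exists i, w (t i) = 0.
    have /eqP := congr1 (fun q => q.[0]) wE.
    rewrite hornerD hornerXn hornerX expr0n gtn_eqF // addr0 horner_prod eq_sym.
    rewrite prodf_seq_eq0 => /hasP[i _ /=]; rewrite hornerXsubC sub0r oppr_eq0.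
    by move=> /eqP wi; exists ((t^-1)%g i); rewrite permKV.
  have uniq_i0 i : w (t i) = 0 -> i = i0.
    move=> wi; apply/eqP/negPn/negP => ii0.
    have := congr1 (fun q => q^`().[0]) wE.
    rewrite derivD derivXn derivX hornerD hornerMn hornerXn hornerC expr0n gtn_eqF; last by lia.
    rewrite mul0rn add0r (bigD1 (t i0)) //= (bigD1 (t i)) /=; last by rewrite (inj_eq perm_inj).
    rewrite deriv_mul_root2 => [/eqP||]; first by rewrite oner_eq0.
      by rewrite root_XsubC wi0.
    by rewrite rootM root_XsubC wi eqxx.
  rewrite (eq_bigr (fun i => if e i i0 then \prod_(l < m | ~~ e i0 l) w (t l) else 0));
    last first.
    move=> i _; case: ifP => ii0.
      by apply: eq_bigl => l; have [_ ->] := eqe i i0 l.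
    by rewrite (bigD1 i0) ?ii0 //= wi0 mul0r.
  rewrite -big_mkcond sumr_const -mulr_natl mulf_neq0 //.
    have /pcharf0P -> : [pchar k2] =i pred0 by move=> q; rewrite (fmorph_pchar h2) k0.
    rewrite -lt0n (leq_trans d0) // -(cardd i0); apply: subset_leq_card.
    by apply/subsetP => l; rewrite !inE e_sym.
  apply/prodf_neq0 => l i0l; apply: contra i0l => /eqP/uniq_i0 ->; exact: e_refl.
have g2Jt : g2 Jt = 1 by rewrite /g2 /= horner_evalE Jt0 rmorph1.
(* If E2 > (m-1) N, then [P'] would vanish at s = 0; if E2 < (m-1) N, so that [a] is nonzero, then
   [b0] would. Equality makes m - 1 divide d - 1, and 0 < d < m leaves d = 1. *)
case: (leqP (m.-1 * N) E2) => NE.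
  have hb : mmap fK W P' = fK (b0 * 'X ^+ (E2 - m.-1 * N)).
    apply: (mulIf (expf_neq0 (m.-1 * N) s0)); rewrite main.
    by rewrite -{1}(subnK NE) exprD mulrA [in LHS]rmorphM rmorphXn.
  have [t] := mpoly_specialize fK_inj WE' g2T hb.
  rewrite rmorphM rmorphXn g2X expr0n => E; have := P'nz t; rewrite -E.
  have [NE' _|_] := eqVneq (E2 - m.-1 * N)%N 0%N; last by rewrite mulr0 eqxx.
  have NE2 : (m.-1 * j + d = m.-1 * N.+1 + 1)%N.
    have : (m <= m.-1 * j)%N by nia.
    by move: NE NE'; rewrite /E2; lia.
  by case: (ltngtP j N.+1) => jN; nia.
have Nz : (0 < N)%N.
  by rewrite lt0n; apply: contraTneq NE => ->; rewrite muln0.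
have hb : mmap fK W ('X%:MP ^+ (m.-1 * N - E2) * P') = fK b0.
  have -> : mmap fK W ('X%:MP ^+ (m.-1 * N - E2) * P')
      = s ^+ (m.-1 * N - E2) * mmap fK W P' by rewrite rmorphM rmorphXn /= mmapC.
  apply: (mulIf (expf_neq0 E2 s0)); rewrite -[in RHS]rmorphXn -[RHS]rmorphM -[RHS]main.
  by rewrite -{2}(subnK (ltnW NE)) exprD; ring.
have [t] := mpoly_specialize fK_inj WE' g2T hb.
have -> : mmap g2 (fun i => w (t i)) ('X%:MP ^+ (m.-1 * N - E2) * P') = 0.
  rewrite rmorphM rmorphXn -[_ 'X%:MP]/(mmap g2 _ _) mmapC.
  rewrite -[X in X ^+ _ * _]/(g2 'X) g2X expr0n.
  by rewrite gtn_eqF ?subn_gt0 // mul0r.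
rewrite -[_ b0]/(g2 b0) /b0 (rmorphM g2) (rmorphM g2) !(rmorphXn g2) rmorphN1.
rewrite g2Jt expr1n mulr1 => /eqP.
rewrite mulf_eq0 signr_eq0 /= fmorph_eq0 horner_evalE horner_sum big_ord_recr /=.
rewrite big1 ?add0r => [|i _]; last first.
  rewrite hornerZ hornerXn expr0n gtn_eqF ?mulr0 //.
  by rewrite muln_gt0 subn_gt0 ltn_ord andbT; lia.
rewrite hornerZ hornerXn subnn muln0 mulr1 -lead_coefE lead_coef_eq0 => /eqP az.
by rewrite /N az size_poly0 in Nz.
Qed.

(** * From transpositions to the full symmetric group *)

Lemma tperm_trans (T : finType) (H : {group {perm T}}) (x y z : T) :
  tperm x y \in H -> tperm y z \in H -> tperm x z \in H.
Proof.
move=> xy yz; have [->|zx] := eqVneq z x; first by rewrite tperm1 group1.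
have [->//|zy] := eqVneq z y.
suff -> : tperm x z = (tperm y z ^ tperm x y)%g by rewrite groupJ.
by rewrite tpermJ tpermR tpermD // eq_sym.
Qed.

Lemma tperm_all_full (T : finType) (H : {group {perm T}}) :
  (forall x y, tperm x y \in H) -> H :=: setT.
Proof.
move=> all_H; have [x _|noT] := pickP (@predT T); last first.
  apply/setP => s; rewrite inE (_ : s = 1%g) ?group1 //.
  by apply/permP => x; move: (noT x).
apply/eqP; rewrite eqEsubset subsetT -(gen_tperm x) gen_subG.
by apply/subsetP => _ /imsetP[y _ ->].
Qed.

Section TutteGroup.
Variables (k : fieldType) (iota : {rmorphism rat -> k}) (m j p e : nat).
Hypotheses (p_pr : prime p) (pj : ~~ (p %| j)%N) (j1 : (1 < j)%N).
Hypotheses (mE : m = (p ^ e)%N) (m2 : (2 < m)%N).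

(** Galois theory enters only through the hypothesis that [H]-invariant polynomial expressions in
    the roots come from k[y]. *)
Lemma tut_group_full (R : idomainType) (f : {rmorphism {poly k} -> R})
  (v : 'I_m -> R) (H : {group 'S_m}) :
  injective f -> tut m j (f 'X) = \prod_(i < m) ('X - (v i)%:P) ->
  (forall P : {mpoly {poly k}[m]},
     (forall s, s \in H -> mmap f v (msym s P) = mmap f v P) ->
     exists a, mmap f v P = f a) ->
  H :=: setT.
Proof.
move=> f_inj fT inv; have m1 := ltnW m2.
pose r : rel 'I_m := fun x y => tperm x y \in H.
have r_sym x y : r x y = r y x by rewrite /r tpermC.
have rH s x y : s \in H -> r (s x) (s y) = r x y.
  by move=> sH; rewrite /r -tpermJ groupJr.
have eqr : equivalence_rel r.
  move=> x y z; split=> [|xy]; first by rewrite /r tperm1 group1.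
  apply/idP/idP => h; last exact: tperm_trans xy h.
  by apply: tperm_trans h; rewrite tpermC.
pose i0 : 'I_m := Ordinal (ltnW m1).
(* The points whose block has the size of that of [i0] form a nonempty [H]-stable set, so
   transitivity makes it everything. *)
have cardr i : #|[pred l | r i l]| = #|[pred l | r i0 l]|.
  pose O := [set i | #|[pred l | r i l]| == #|[pred l | r i0 l]|].
  have [|O0|OT] := tut_transitive iota j1 m1 (O := O) f_inj fT inv.
  - move=> s l sH; rewrite !inE; congr (_ == _).
    rewrite -[RHS](card_image (@perm_inj _ s)); apply: eq_card => x.
    rewrite !inE; apply/idP/imageP => [rx|[z rz ->]]; last by rewrite rH.
    by exists ((s^-1)%g x); rewrite ?permKV // inE -(rH s) // permKV.
  - by have := in_set0 i0; rewrite -O0 inE eqxx.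
  - by have := in_setT i; rewrite -OT inE => /eqP.
have [a va] : exists a, \sum_(i < m) \prod_(l < m | r i l) v l = f a.
  pose P : {mpoly {poly k}[m]} := \sum_(i < m) \prod_(l < m | r i l) 'X_l.
  have PE u : mmap f u P = \sum_(i < m) \prod_(l < m | r i l) u l.
    rewrite raddf_sum; apply: eq_bigr => i _; rewrite /= rmorph_prod.
    by apply: eq_bigr => l _; rewrite /= mmapXU.
  have [|a Pa] := inv P; last by exists a; rewrite -PE.
  move=> s sH; rewrite mmap_msym !PE [RHS](reindex_inj (@perm_inj _ s)) /=.
  apply: eq_bigr => i _; rewrite [RHS](reindex_inj (@perm_inj _ s)) /=.
  by apply: eq_bigl => l; rewrite rH.
have [a' [b [ab tab]]] := exists_tperm iota p_pr pj j1 mE m1 f_inj fT inv.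
have [d1|dm] := tut_no_block (pchar_rat_ext iota) m2 j1 f_inj fT eqr cardr va.
  have : (1 < #|[pred l | r i0 l]|)%N.
    rewrite -(cardr a') (cardD1 a') inE /= {1}/r tperm1 group1 (cardD1 b).
    by rewrite !inE /= eq_sym ab [r _ _]tab.
  by rewrite d1.
apply: tperm_all_full => x y.
have cx : #|[pred l | r x l]| = #|'I_m| by rewrite cardr dm card_ord.
by have := subset_cardP cx (subset_predT _) y; rewrite !inE.
Qed.

End TutteGroup.

(** * The Galois group as a permutation group *)

Section GaloisGroup.
Variables (k : fieldType) (L : splittingFieldType {fraction {poly k}}).
Variables (E : {subfield L}) (m : nat) (T : {poly {poly k}}) (v : 'I_m -> L).
Local Notation G := ('Gal(E / 1%AS))%g.

Definition poly_in_ext : {rmorphism {poly k} -> L} :=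
  in_alg L \o @FracField.tofrac {poly k}.

Lemma poly_in_ext_inj : injective poly_in_ext.
Proof. by move=> a b /fmorph_inj /eqP; rewrite tofrac_eq => /eqP. Qed.

Lemma map_over_ratfun :
  map_poly (in_alg L) (over_ratfun T) = map_poly poly_in_ext T.
Proof. by rewrite [RHS]map_poly_comp. Qed.

Hypothesis monT : T \is monic.
Hypothesis TE : map_poly poly_in_ext T = \prod_(i < m) ('X - (v i)%:P).
Hypothesis v_inj : injective v.
Hypothesis galE : splittingFieldFor 1%AS (map_poly poly_in_ext T) E.

Lemma poly_in_ext1 a : poly_in_ext a \in (1%VS : {vspace L}).
Proof. exact: rpredZ (rpred1 _). Qed.

Lemma root_poly_ext x :
  root (map_poly poly_in_ext T) x = [exists i, v i == x].
Proof.
rewrite TE /root horner_prod prodf_seq_eq0; apply/hasP/existsP => [[i _ /=]|[i]].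
  by rewrite hornerXsubC subr_eq0 eq_sym => vi; exists i.
by move=> /eqP<-; exists i; rewrite ?mem_index_enum //= hornerXsubC subrr.
Qed.

Lemma ext_galois : galois 1%AS E.
Proof.
apply/splitting_galoisField; exists (map_poly poly_in_ext T); split=> //.
  by apply/polyOverP => i; rewrite coef_map poly_in_ext1.
rewrite TE -(big_map v xpredT (fun z => 'X - z%:P)) separable_prod_XsubC.
by rewrite map_inj_uniq // index_enum_uniq.
Qed.

Lemma root_in_ext i : v i \in E.
Proof.
have [rs rsE <-] := galE; apply: seqv_sub_adjoin.
rewrite -root_prod_XsubC -(eqp_root rsE) root_poly_ext.
by apply/existsP; exists i.
Qed.

Lemma gal_poly_in_ext (g : gal_of E) a : g (poly_in_ext a) = poly_in_ext a.
Proof. exact: rmorph_alg. Qed.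

Lemma gal_root (g : gal_of E) i : exists l, g (v i) = v l.
Proof.
suff : root (map_poly poly_in_ext T) (g (v i)).
  by rewrite root_poly_ext => /existsP[l /eqP]; exists l.
have -> : map_poly poly_in_ext T = map_poly g (map_poly poly_in_ext T).
  rewrite -map_poly_comp; apply: eq_map_poly => a /=.
  by rewrite gal_poly_in_ext.
by apply: rmorph_root; rewrite root_poly_ext; apply/existsP; exists i.
Qed.

(** The default [i] is never reached, by [gal_root]. *)
Definition gal_perm_fun (g : gal_of E) i : 'I_m :=
  odflt i [pick l | g (v i) == v l].

Lemma gal_perm_funE g i : v (gal_perm_fun g i) = g (v i).
Proof.
rewrite /gal_perm_fun; case: pickP => [l /eqP //|no].
by have [l /eqP] := gal_root g i; rewrite no.
Qed.

Lemma gal_perm_fun_inj g : injective (gal_perm_fun g).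
Proof.
move=> i l /(congr1 v); rewrite !gal_perm_funE => /fmorph_inj; exact: v_inj.
Qed.

Definition gal_perm g : 'S_m := perm (@gal_perm_fun_inj g).

Lemma gal_permE g i : v (gal_perm g i) = g (v i).
Proof. by rewrite permE gal_perm_funE. Qed.

Lemma gal_permM : {in G &, {morph gal_perm : x y / (x * y)%g}}.
Proof.
move=> x y xG yG; apply/permP => i; apply: v_inj.
by rewrite permM !gal_permE galM ?root_in_ext // -gal_permE.
Qed.
Canonical gal_perm_morphism := Morphism gal_permM.

Lemma gal_perm_injm : ('injm gal_perm_morphism)%g.
Proof.
apply/subsetP => z /morphpreP[zG /set1P z1]; apply/set1P/eqP/gal_eqP => x xE.
have fixv i : z (v i) = v i by rewrite -gal_permE [gal_perm z]z1 perm1.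
rewrite gal_id; suff sEz : (E <= fixedField [set z])%VS.
  by have /mem_fixedFieldP[_ ->] := subvP sEz x xE; rewrite ?inE.
have [rs rsE defE] := galE; rewrite -[X in (X <= _)%VS]defE.
apply/Fadjoin_seqP; split=> [|y yrs]; first exact: sub1v.
have : root (map_poly poly_in_ext T) y by rewrite (eqp_root rsE) root_prod_XsubC.
rewrite root_poly_ext => /existsP[i /eqP <-].
by apply/fixedFieldP => [|_ /set1P ->]; rewrite ?root_in_ext ?fixv.
Qed.

(** The invariant value lies in k(y) by the Galois correspondence and is integral over k[y], as [T]
    is monic; k[y] being integrally closed, it lies in k[y]. *)
Lemma gal_invariant (P : {mpoly {poly k}[m]}) :
  (forall s, s \in (gal_perm_morphism @* G)%g ->
     mmap poly_in_ext v (msym s P) = mmap poly_in_ext v P) ->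
  exists a, mmap poly_in_ext v P = poly_in_ext a.
Proof.
move=> inv; set x := mmap _ _ P.
have xE : x \in E.
  rewrite /x /mmap rpred_sum // => u _; rewrite rpredM //.
    exact: subvP (sub1v _) _ (poly_in_ext1 _).
  by rewrite /mmap1 rpred_prod // => i _; rewrite rpredX ?root_in_ext.
have : x \in fixedField G.
  apply/fixedFieldP => // g gG.
  rewrite /x (mmap_morph _ g) -(inv (gal_perm g)) ?mmap_msym.
    by apply: eq_mmap => z; rewrite /= ?gal_permE // gal_poly_in_ext.
  by apply: mem_morphim.
rewrite (galois_fixedField ext_galois) => /vlineP[c xc].
have : integralOver poly_in_ext x.
  apply: integral_mmap => i; exists T => //.
  by rewrite root_poly_ext; apply/existsP; exists i.
case=> q mon_q; rewrite xc map_poly_comp => qc.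
have [|a ca] := @fraction_poly_integral k c.
  exists q => //; move: qc; rewrite (_ : c *: 1 = in_alg L c) //.
  by rewrite fmorph_root.
by exists a; rewrite ca.
Qed.

End GaloisGroup.

(** * The Galois group of the Tutte polynomial *)

Lemma gal_tut_isog (k : fieldType) (iota : {rmorphism rat -> k}) (m j p e : nat)
    (L : splittingFieldType {fraction {poly k}}) (E : {subfield L}) :
  prime p -> ~~ (p %| j)%N -> (1 < j)%N -> m = (p ^ e)%N -> (2 < m)%N ->
  splittingFieldFor 1%AS (map_poly (in_alg L) (over_ratfun (tut m j 'X))) E ->
  ('Gal(E / 1%AS) \isog [set: 'S_m])%g.
Proof.
move=> p_pr pj j2 mE m2; rewrite map_over_ratfun => galE.
have [rs rsE defE] := galE; pose f := @poly_in_ext k L.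
have [monT sT] := tut_monic_size j ('X : {poly k}) (ltnW (ltnW m2)).
have TE0 : map_poly f (tut m j 'X) = \prod_(z <- rs) ('X - z%:P).
  by apply/eqP; rewrite -eqp_monic ?monic_prod_XsubC ?monic_map.
have srs : size rs = m.
  have := congr1 (fun q : {poly L} => size q) TE0.
  rewrite size_prod_XsubC (size_map_inj_poly (@poly_in_ext_inj k L)) ?rmorph0 //.
  by rewrite sT => -[].
pose v (i : 'I_m) := rs`_i.
have TE : map_poly f (tut m j 'X) = \prod_(i < m) ('X - (v i)%:P).
  by rewrite TE0 (big_nth 0) srs big_mkord.
(* The discriminant is nonzero, since its derivative is nonzero at some point of an extension. *)
have v_inj : injective v.
  apply: vdm_inj; rewrite -sqrf_eq0 -(discE TE) -(rmorph0 f).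
  rewrite (inj_eq (@poly_in_ext_inj k L)).
  have [K [h [y [w [_ _ D'y]]]]] :=
    exists_simple_root_disc iota p_pr pj j2 mE (ltnW m2).
  by apply: contraNneq D'y => ->; rewrite rmorph0 deriv0 horner0.
have TE' : tut m j (f 'X) = \prod_(i < m) ('X - (v i)%:P).
  by rewrite -TE tut_morph.
have inv := @gal_invariant k L E m _ v monT TE v_inj galE.
rewrite -(tut_group_full iota p_pr pj j2 mE m2 (@poly_in_ext_inj k L) TE' inv).
by apply: sub_isog; [exact: subxx | exact: gal_perm_injm].
Qed.

Theorem theorem4p16 (k : fieldExtType rat) (n j p : nat)
    (L : splittingFieldType {fraction {poly k}}) (E : {subfield L}) :
  (2 <= n)%N -> (1 <= j)%N ->
  prime p -> (5 <= p)%N ->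
  ((n - 1)%N = p \/ (n - 1)%N = (p ^ 2)%N) ->
  ~ (exists a : int, (a ^+ 2 = - j%:Z %[mod p%:Z])%Z) ->
  gcdn n (j - 1) = 1%N ->
  splittingFieldFor 1%AS (map_poly (in_alg L) (over_ratfun (tutte_C k n j))) E ->
  'Gal(E / 1%AS) \isog [set: 'S_(n - 1)].
Proof.
move=> n2 j1 p_pr p5 nE nonsq cop galE.
have [e mE] : exists e, (n - 1 = p ^ e)%N.
  by case: nE => ->; [exists 1%N; rewrite expn1 | exists 2%N].
(* For j = 1 the gcd would be n, which is at least 2. *)
have j2 : (1 < j)%N.
  case: j j1 cop {galE nonsq} => [|[|j]] //= _; rewrite subnn gcdn0; lia.
(* If p divided j, then -j would be the square of 0 modulo p. *)
have pj : ~~ (p %| j)%N.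
  apply/negP => pj; apply: nonsq; exists 0; rewrite expr2 mul0r.
  by apply/eqP; rewrite eqz_mod_dvd sub0r opprK dvdzE.
have m2 : (2 < n - 1)%N.
  by case: nE => ->; [lia | rewrite -mulnn; nia].
rewrite tutte_CE in galE.
exact: (@gal_tut_isog k (in_alg k) (n - 1) j p e L E p_pr pj j2 mE m2 galE).
Qed.
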